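(* For each $m\ge1$, as $N\to\infty$, $$(J^N_1,J^N_2,\dots,J^N_m)\Longrightarrow(J_1,J_2,\dots,J_m),$$ where the weak convergence is relative to the $m$-fold product topology on $\mathcal C_0(\mathbb R)$.
   Context: Standing assumptions: $\nu$ is an offspring distribution on $\{0,1,2,\dots\}$ with mean $1$ and finite, positive variance $\sigma_\nu^2$; $F$ is a probability distribution on $\mathbb Z$ with span one (not supported on a coset $a+d\mathbb Z$ with $d\ge2$), mean $0$ and finite, positive variance $\sigma_F^2$. Branching random walk and its labeled tree: let $T$ be the genealogical tree of a Galton-Watson process with one ancestor (the root $\rho$) and offspring distribution $\nu$; $T$ is finite almost surely. Conditionally on $T$, let $\{\xi_e\}$ be i.i.d. with law $F$, indexed by the directed edges $e=(u,v)$ of $T$ ($u$ the parent of $v$). Define labels by $l(\rho)=0$ and $l(v)=l(u)+\xi_{(u,v)}$. The labeled tree is $\mathcal T=(T,\{l(v)\}_{v\in T})$. For $j\in\mathbb Z$ let $X(j;\mathcal T)$ be the number of vertices $v\in T$ with $l(v)=j$. Rescaled densities: let $\mathcal T^1,\mathcal T^2,\dots$ be i.i.d. copies of $\mathcal T$. For integers $m\ge 0$ let $X^m(j)=\sum_{i=1}^m X(j;\mathcal T^i)$, $j\in\mathbb Z$, and let $\bar X^m(x)$, $x\in\mathbb R$, be its linear interpolation. For integers $N\ge1$, $s\ge0$, $x\in\mathbb R$ set $g^N_s(x)=N^{-3/2}\,\bar X^{\lfloor sN\rfloor}(\sqrt N\,x)$. $\mathcal C_0(\mathbb R)$ is the space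 of continuous real functions on $\mathbb R$ vanishing at infinity, with the supremum norm; $\mathbb D([0,+\infty),\mathcal C_0(\mathbb R))$ is the space of càdlàg $\mathcal C_0(\mathbb R)$-valued functions on $[0,+\infty)$ with the Skorohod topology. The processes $\{g^N_s\}_{s\ge0}$ converge weakly in this space as $N\to\infty$ to a process $\{g_s\}_{s\ge0}$, which is nondecreasing in $s$ for the pointwise order and has jump discontinuities. Ordered jumps of the limit: the jumps $g_t-g_{t-}\in\mathcal C_0(\mathbb R)$ of $\{g_s\}$ that occur before time $t=1$ are ordered by total area $\int(g_t-g_{t-})(x)\,dx$ and denoted $J_1,J_2,\dots$, with $\int J_1>\int J_2>\int J_3>\cdots$ (almost surely no two jumps have the same area). Ordered jumps of the prelimit: for each $N$, order the trees $\mathcal T^i$, $i\le N$, by their size (number of vertices), from largest to smallest (ties broken by a fixed rule, e.g. smaller index first). If the $j$th largest tree among the first $N$ is $\mathcal T^{i}$, then $J^N_j:=g^N_{i/N}-g^N_{(i-1)/N}\in\mathcal C_0(\mathbb R)$ is the corresponding jump of $g^N$ (defined for $j\le N$). *)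

(* Defs.v *)
From HB Require Import structures.
From mathcomp Require Import all_boot all_order all_algebra.
From mathcomp Require Import finmap.
From mathcomp Require Import all_classical all_reals all_analysis.
From mathcomp Require Import zify ring lra.

Set Implicit Arguments.
Unset Strict Implicit.
Unset Printing Implicit Defensive.

Import Order.TTheory GRing.Theory Num.Theory.
Import numFieldNormedType.Exports.

Local Open Scope classical_set_scope.
Local Open Scope ring_scope.

Section C0.
Variable R : realType.

Definition vanishing_continuous : {pred R -> R} :=
  [pred f | `[< [/\ continuous f, f x @[x --> +oo] --> (0 : R)
                  & f x @[x --> -oo] --> (0 : R)] >] ].

Lemma vanishing_continuousP (f : R -> R) :
  reflect [/\ continuous f, f x @[x --> +oo] --> (0 : R)
            & f x @[x --> -oo] --> (0 : R)]
          (f \in vanishing_continuous).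
Proof. by rewrite inE; exact: asboolP. Qed.

Fact vanishing_continuous_submod : submod_closed vanishing_continuous.
Proof.
split=> [|a f g /vanishing_continuousP[cf pf nf] /vanishing_continuousP[cg pg ng]].
  by apply/vanishing_continuousP; split; [move=> x; exact: cvg_cst|exact: cvg_cst..].
apply/vanishing_continuousP; split.
- by move=> x; apply: cvgD; [apply: cvgM; [exact: cvg_cst|exact: cf]|exact: cg].
- suff : a * f x + g x @[x --> +oo] --> a * 0 + 0 by rewrite mulr0 addr0.
  by apply: cvgD => //; apply: cvgM => //; exact: cvg_cst.
- suff : a * f x + g x @[x --> -oo] --> a * 0 + 0 by rewrite mulr0 addr0.
  by apply: cvgD => //; apply: cvgM => //; exact: cvg_cst.
Qed.

HB.instance Definition _ :=
  GRing.isSubmodClosed.Build R (R -> R) vanishing_continuous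
    vanishing_continuous_submod.

Record c0 := MkC0 { c0_fun :> R -> R; _ : c0_fun \in vanishing_continuous }.

HB.instance Definition _ := [isSub for c0_fun].
HB.instance Definition _ := [Choice of c0 by <:].
HB.instance Definition _ := [SubChoice_isSubLmodule of c0 by <:].

Lemma c0P (f : c0) :
  [/\ continuous f, f x @[x --> +oo] --> (0 : R)
    & f x @[x --> -oo] --> (0 : R)].
Proof. by apply/vanishing_continuousP; case: f. Qed.

Lemma c0_eqP (f g : c0) : f =1 g -> f = g.
Proof. by move=> fg; apply: val_inj; apply/funext. Qed.

Lemma c0_bounded (f : c0) : exists M, forall x, `|f x| <= M.
Proof.
have [cf pf nf] := c0P f.
have /pf[A [_ fA]] : nbhs (0 : R) (ball (0 : R) 1) by exact: nbhsx_ballx.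
have /nf[B [_ fB]] : nbhs (0 : R) (ball (0 : R) 1) by exact: nbhsx_ballx.
pose a := Num.min A B - 1; pose b := Num.max A B + 1.
have [aA bA] : a < A /\ A < b.
  have : Num.min A B <= A by rewrite ge_min lexx.
  have : A <= Num.max A B by rewrite le_max lexx.
  by rewrite /a /b; lra.
have aB : a < B.
  have : Num.min A B <= B by rewrite ge_min lexx orbT.
  by rewrite /a; lra.
have ab : a <= b by lra.
have cnf : {within `[a, b], continuous (fun x => `|f x|)}.
  apply: continuous_subspaceT => x.
  by apply: continuous_comp; [exact: cf|exact: norm_continuous].
have [c _ fc] := EVT_max ab cnf.
exists (Num.max `|f c| 1) => x; rewrite le_max.
have [xab|] := boolP (x \in `[a, b]); first by rewrite fc.
rewrite in_itv/= negb_and -!ltNge => /orP[xa|bx]; apply/orP; right.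
  have /fB : x < B by lra.
  by rewrite /ball/= sub0r normrN => /ltW.
have /fA : A < x by lra.
by rewrite /ball/= sub0r normrN => /ltW.
Qed.

Definition c0_norm (f : c0) : R := sup (range (fun x => `|f x|)).

Lemma c0_norm_ub (f : c0) x : `|f x| <= c0_norm f.
Proof.
apply: sup_upper_bound; last by exists x.
split; first by exists `|f 0|, 0.
by have [M fM] := c0_bounded f; exists M => _ [y _ <-].
Qed.

Lemma c0_norm_le (f : c0) (M : R) : (forall x, `|f x| <= M) -> c0_norm f <= M.
Proof.
by move=> fM; apply: ge_sup => [|_ [y _ <-]//]; exists `|f 0|, 0.
Qed.

Fact c0_ler_normD (f g : c0) : c0_norm (f + g) <= c0_norm f + c0_norm g.
Proof.
apply: c0_norm_le => x; apply: (le_trans (ler_normD (f x) (g x))).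
by apply: lerD; exact: c0_norm_ub.
Qed.

Fact c0_normrZ (l : R) (f : c0) : c0_norm (l *: f) = `|l| * c0_norm f.
Proof.
apply/eqP; rewrite eq_le; apply/andP; split.
  apply: c0_norm_le => x; rewrite [X in `|X|](_ : _ = l * f x)// normrM.
  by apply: ler_wpM2l => //; exact: c0_norm_ub.
have [->|l0] := eqVneq l 0.
  by rewrite normr0 mul0r (le_trans _ (c0_norm_ub _ 0)).
rewrite mulrC -ler_pdivlMr ?normr_gt0//; apply: c0_norm_le => x.
rewrite ler_pdivlMr ?normr_gt0// mulrC -normrM.
exact: (c0_norm_ub (l *: f)).
Qed.

Fact c0_normr0_eq0 (f : c0) : c0_norm f = 0 -> f = 0.
Proof.
move=> f0; apply: c0_eqP => x; apply/eqP.
by rewrite [X in _ == X](_ : _ = 0)// -normr_le0 -f0 c0_norm_ub.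
Qed.

HB.instance Definition _ :=
  Lmodule_isNormed.Build R c0 c0_ler_normD c0_normrZ c0_normr0_eq0.

End C0.

(** A path on [0, +oo) is represented by its extension to the whole line that is
    constant on (-oo, 0], so that two paths are equal as soon as they agree on
    [0, +oo), and no path jumps at 0. *)
Section Skorohod.
Variables (R : realType) (V : normedModType R).

Definition is_cadlag : pred (R -> V) := fun y =>
  `[< [/\ forall t, t <= 0 -> y t = y 0,
          forall t, y s @[s --> t^'+] --> y t
        & forall t, cvg (y s @[s --> t^'-])] >].

Record cadlag := MkCadlag { cadlag_fun :> R -> V; _ : is_cadlag cadlag_fun }.

HB.instance Definition _ := [isSub for cadlag_fun].
HB.instance Definition _ := [Choice of cadlag by <:].

Definition jump (y : cadlag) (t : R) : V := y t - lim (y s @[s --> t^'-]).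

Definition time_change (lam : R -> R) :=
  set_bij [set t | 0 <= t] [set t | 0 <= t] lam /\
  (forall s t, 0 <= s -> s < t -> lam s < lam t).

(** The sets [skorohod_nbhs y T e] form a neighbourhood base at [y] for
    Skorohod's J1 topology (Ethier and Kurtz, Markov Processes, Prop. 3.5.3). *)
Definition skorohod_nbhs (y : cadlag) (T e : R) : set cadlag :=
  [set z | exists lam, time_change lam /\
     forall t, 0 <= t <= T -> `|lam t - t| < e /\ `|z (lam t) - y t| < e].

Definition skorohod_open : set_system cadlag := [set U | forall y, U y ->
  exists T e : R, 0 < e /\ skorohod_nbhs y T e `<=` U].

Fact skorohod_openT : skorohod_open setT.
Proof. by move=> y _; exists 0, 1. Qed.

Fact skorohod_openI : setI_closed skorohod_open.
Proof.
move=> U U' oU oU' y [/oU[T [e [e0 TeU]]] /oU'[T' [e' [e'0 TeU']]]].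
exists (Num.max T T'), (Num.min e e'); split; first by rewrite lt_min e0.
move=> z [lam [tlam zlam]]; split; [apply: TeU|apply: TeU'];
  exists lam; split=> // t /andP[t0 tT];
  by have := zlam t; rewrite t0 le_max tT ?orbT !lt_min => /(_ isT)[/andP[? ?] /andP[]].
Qed.

Fact skorohod_open_bigU (I : Type) (f : I -> set cadlag) :
  (forall i, skorohod_open (f i)) -> skorohod_open (\bigcup_i f i).
Proof.
move=> of_ y [i _ /of_[T [e [e0 Tef]]]]; exists T, e; split=> // z /Tef.
by exists i.
Qed.

HB.instance Definition _ := isOpenTopological.Build cadlag
  skorohod_openT skorohod_openI skorohod_open_bigU.

End Skorohod.

Definition ordered_jumps (R : realType) (y : cadlag (c0 R)) (j : nat -> c0 R) :=
  exists tau : nat -> R,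
    [/\ injective tau,
        range tau = [set t | 0 < t < 1 /\ jump y t <> 0],
        forall k, j k = jump y (tau k)
      & forall k, (\int[lebesgue_measure]_x (j k.+1 x)%:E <
                   \int[lebesgue_measure]_x (j k x)%:E)%E].

HB.instance Definition _ := isPointed.Build int 0.
HB.instance Definition _ := @isMeasurable.Build default_measure_display
  int discrete_measurable discrete_measurable0
  discrete_measurableC discrete_measurableU.

Section Probability.
Context {d : measure_display} {Omega : measurableType d} {R : realType}
  (P : probability Omega R).

Definition independent_systems (I : choiceType) (E : I -> set_system Omega) :=
  forall (s : {fset I}) (A : I -> set Omega), (forall i, i \in s -> E i (A i)) ->
    P (\bigcap_(i in [set` s]) A i) = (\prod_(i <- s) P (A i))%E.

Definition generated_by d' (T : measurableType d') (X : Omega -> T) :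
  set_system Omega := preimage_set_system setT X measurable.

Definition random_element (S : topologicalType) (X : Omega -> S) :=
  forall U : set S, open U -> measurable (X @^-1` U).

End Probability.

Definition cvg_in_law (R : realType) d d' (Omega : measurableType d)
    (Omega' : measurableType d') (P : probability Omega R)
    (P' : probability Omega' R) (S : topologicalType)
    (X : nat -> Omega -> S) (Y : Omega' -> S) :=
  [/\ forall N, random_element (X N),
      random_element Y
    & forall h : S -> R, continuous h -> (exists M : R, forall x, `|h x| <= M) ->
        ('E_P[h \o X N] @[N --> \oo] --> 'E_P'[h \o Y])%E].

Definition critical_offspring (R : realType) (nu : probability nat R) :=
  ('E_nu[fun k => k%:R] = 1 /\ 0 < 'V_nu[fun k => k%:R] < +oo)%E.

Definition centered_span1 (R : realType) (F : probability int R) :=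
  [/\ forall (a : int) (p : nat), (2 <= p)%N ->
        F [set x | (p %| x - a)%Z] <> 1%E,
      ('E_F[fun x => x%:~R] = 0)%E
    & (0 < 'V_F[fun x => x%:~R] < +oo)%E].

(** Ulam-Harris encoding: a vertex is a word, the children of the vertex [u] are
    the words [rcons u k] with [k < K u], where [K u] is the number of children
    of [u]; [xi u k] is the displacement along the edge from [u] to [rcons u k]. *)
Section LabeledTree.
Variables (K : seq nat -> nat) (xi : seq nat -> nat -> int).

Definition genealogical_tree : set (seq nat) :=
  [set v | forall k, (k < size v)%N -> (nth 0 v k < K (take k v))%N].

(** An infinite tree, which is an event of probability zero for a critical
    offspring law, is given the empty set of vertices. *)
Definition vertices : {fset seq nat} := fset_set genealogical_tree.

Definition tree_size : nat := #|` vertices|.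

Definition label (v : seq nat) : int :=
  \sum_(k < size v) xi (take k v) (nth 0 v k).

Definition occupation (j : int) : nat :=
  count (fun v => label v == j) (vertices : seq (seq nat)).

End LabeledTree.

Definition linear_interpolation (R : realType) (X : int -> R) (x : R) : R :=
  let j := Num.floor x in
  (1 - (x - j%:~R)) * X j + (x - j%:~R) * X (j + 1).

Section Interpolation.
Variable R : realType.

Let tent (x : R) : R := Num.max 0 (1 - `|x|).

Let interpolation_delta (i : int) (x : R) :
  linear_interpolation (fun j => (i == j)%:R) x = tent (x - i%:~R).
Proof.
rewrite /linear_interpolation /tent; move: (floor_itv x).
move: (Num.floor x) => j /andP[jx xj].
rewrite intrD in xj; rewrite /=.
have [->|ij] := eqVneq i j.
  have -> : (j == j + 1) = false by rewrite lt_eqF// ltrDl.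
  by rewrite /= ger0_norm ?subr_ge0// max_r; lra.
have [->|ij1] := eqVneq i (j + 1).
  by rewrite /= intrD ler0_norm ?max_r; lra.
rewrite !mulr0 addr0 max_l// subr_le0.
have [ilt|ige] := ltP i j.
  have : (i + 1)%:~R <= j%:~R :> R by rewrite ler_int; lia.
  rewrite intrD => ?; apply: (le_trans _ (ler_norm _)); lra.
have : (j + 1 + 1)%:~R <= i%:~R :> R by rewrite ler_int; lia.
rewrite !intrD => ?; rewrite -normrN; apply: (le_trans _ (ler_norm _)); lra.
Qed.

Let tent_vanishing (a : R) (i : int) : 0 < a ->
  (fun x => tent (a * x - i%:~R)) \in @vanishing_continuous R.
Proof.
move=> a0; apply/vanishing_continuousP; split.
- move=> x; apply: (@continuous_max _ _ (fun=> 0) (fun x => 1 - `|a * x - i%:~R|)).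
    exact: cvg_cst.
  apply: cvgB; first exact: cvg_cst.
  apply: cvg_norm; apply: cvgB; last exact: cvg_cst.
  by apply: cvgM; [exact: cvg_cst|exact: cvg_id].
- apply: (@cvg_trans _ ((fun=> 0 : R) @ +oo)); last exact: cvg_cst.
  apply: near_eq_cvg; near=> x.
  rewrite /tent max_l// subr_le0 (le_trans _ (ler_norm _))//.
  by rewrite lerBrDr -ler_pdivrMl.
- apply: (@cvg_trans _ ((fun=> 0 : R) @ -oo)); last exact: cvg_cst.
  apply: near_eq_cvg; near=> x.
  rewrite /tent max_l// subr_le0 -normrN (le_trans _ (ler_norm _))//.
  by rewrite opprB lerBrDl -lerBrDr -ler_pdivlMl.
Unshelve. all: by end_near. Qed.

Lemma interpolation_vanishing (I : eqType) (s : seq I) (l : I -> int) (a : R) :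
  0 < a ->
  (fun x => linear_interpolation
     (fun j => (count (fun i => l i == j) s)%:R) (a * x))
  \in @vanishing_continuous R.
Proof.
move=> a0; rewrite [X in X \in _](_ : _ =
    \sum_(i <- s) (fun x => tent (a * x - (l i)%:~R))).
  by apply: rpred_sum => i _; exact: tent_vanishing.
apply/funext => x; elim: s => [|i s IH].
  by rewrite big_nil /linear_interpolation/= !mulr0 addr0.
rewrite big_cons -[RHS]/(_ + (\sum_(i <- s) _) x) -IH -interpolation_delta.
by rewrite /linear_interpolation/= !natrD; ring.
Qed.

End Interpolation.

Section RescaledDensity.
Variable R : realType.
Variables (K : nat -> seq nat -> nat) (xi : nat -> seq nat -> nat -> int).

(** Trees are numbered from 0, so [rescaled_density N] jumps at time
    [i.+1%:R / N%:R] by the contribution of the tree number [i]. For [s < 0],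
    [Num.truncn (s * N%:R)] is 0. *)
Definition total_occupation (m : nat) (j : int) : nat :=
  \sum_(i < m) occupation (K i) (xi i) j.

Definition rescaled_occupation (N m : nat) (x : R) : R :=
  N%:R `^ (- (3 / 2)) *
  linear_interpolation (fun j => (total_occupation m j)%:R) (Num.sqrt N%:R * x).

Fact rescaled_occupation_vanishing N m :
  rescaled_occupation N m \in @vanishing_continuous R.
Proof.
have [->|N0] := eqVneq N 0%N.
  rewrite [X in X \in _](_ : _ = 0) ?rpred0//; apply/funext => x.
  by rewrite /rescaled_occupation powR0 ?mul0r// oppr_eq0; lra.
pose s := [seq (i, v) | i <- iota 0 m, v <- (vertices (K i) : seq (seq nat))].
rewrite [X in X \in _](_ : _ = N%:R `^ (- (3 / 2)) *:
    (fun x : R => linear_interpolation (fun j =>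
       (count (fun p => label (xi p.1) p.2 == j) s)%:R) (Num.sqrt N%:R * x)) :> (R -> R)).
  by apply: rpredZ; apply: interpolation_vanishing; rewrite sqrtr_gt0 ltr0n lt0n.
apply/funext => x; rewrite /rescaled_occupation.
rewrite [in RHS]/GRing.scale/=; congr (_ * linear_interpolation _ _).
apply/funext => j; congr (_%:R).
rewrite /total_occupation /s count_flatten -map_comp sumnE big_map.
rewrite -(big_mkord xpredT (fun i => occupation (K i) (xi i) j)) /index_iota subn0.
by apply: eq_bigr => i _ /=; rewrite count_map.
Qed.

Definition density (N m : nat) : c0 R :=
  MkC0 (rescaled_occupation_vanishing N m).

Fact density_cadlag N :
  is_cadlag (fun s : R => density N (Num.truncn (s * N%:R))).
Proof.
have step (F : set_system R) (FF : ProperFilter F) (n : nat) :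
    (\forall s \near F, Num.truncn (s * N%:R) = n) ->
    density N (Num.truncn (s * N%:R)) @[s --> F] --> density N n.
  move=> Fn; apply: (@cvg_trans _ ((fun=> density N n) @ F)); last exact: cvg_cst.
  by apply: near_eq_cvg; near=> s; congr (density N _); apply/esym; near: s.
apply/asboolP; split=> [t t0|t|t].
- congr (density N _); rewrite mul0r truncn0; apply/truncn0Pn.
  by rewrite -ltNge (le_lt_trans _ ltr01)// mulr_le0_ge0.
- apply: step; have [t0|t0] := ltP t 0.
    near=> s; rewrite (_ : Num.truncn _ = 0%N); last first.
      apply/truncn0Pn; rewrite -ltNge (le_lt_trans _ ltr01)// mulr_le0_ge0//.
      by near: s; apply: nbhs_right_le.
    apply/esym/truncn0Pn; rewrite -ltNge (le_lt_trans _ ltr01)//.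
    by rewrite mulr_le0_ge0// ltW.
  have [->|N0] := eqVneq N 0%N; first by near=> s; rewrite !mulr0.
  have N0' : 0 < N%:R :> R by rewrite ltr0n lt0n.
  have /andP[nt tn] := truncn_itv (mulr_ge0 t0 (ltW N0')).
  near=> s; apply: truncn_def; apply/andP; split.
    by apply: (le_trans nt); rewrite ler_pM2r//; near: s; exact: nbhs_right_ge.
  rewrite -ltr_pdivlMr//; near: s; apply: nbhs_right_lt.
  by rewrite ltr_pdivlMr.
- have [t0|t0] := leP t 0.
    apply: (@cvgP _ _ (density N 0)); apply: step; near=> s.
    apply/truncn0Pn; rewrite -ltNge (le_lt_trans _ ltr01)// mulr_le0_ge0//.
    by apply: (le_trans _ t0); near: s; exact: nbhs_left_le.
  have [->|N0] := eqVneq N 0%N.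
    apply: (@cvgP _ _ (density 0 0)).
    by under eq_cvg do rewrite mulr0 truncn0; exact: cvg_cst.
  have N0' : 0 < N%:R :> R by rewrite ltr0n lt0n.
  have [k kt tk] : exists2 k : nat, k%:R < t * N%:R & t * N%:R <= k.+1%:R.
    have tN : 0 < t * N%:R by rewrite mulr_gt0.
    have /andP[] := truncn_itv (ltW tN); case: (Num.truncn _) => [|n nt tn].
      by move=> _ /ltW ?; exists 0%N.
    have [nt'|tn'] := ltP n.+1%:R (t * N%:R); first by exists n.+1 => //; exact: ltW.
    by exists n => //; rewrite (lt_le_trans _ nt)// ltr_nat.
  apply: (@cvgP _ _ (density N k)); apply: step; near=> s.
  apply: truncn_def; apply/andP; split.
    rewrite -ler_pdivrMr// ltW//; near: s; apply: nbhs_left_gt.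
    by rewrite ltr_pdivrMr.
  apply: lt_le_trans tk; rewrite ltr_pM2r//; near: s; exact: nbhs_left_lt.
Unshelve. all: by end_near. Qed.

Definition rescaled_density (N : nat) : cadlag (c0 R) :=
  MkCadlag (density_cadlag N).

Definition trees_by_size (N : nat) : seq nat :=
  let size_of i := tree_size (K i) in
  sort (fun i i' => (size_of i' < size_of i)%N ||
                    ((size_of i == size_of i') && (i <= i')%N)) (iota 0 N).

(** Ranks also start from 0; meaningful only for [j < N]. *)
Definition ordered_jump (N j : nat) : c0 R :=
  let i := nth 0%N (trees_by_size N) j in
  rescaled_density N (i.+1%:R / N%:R) - rescaled_density N (i%:R / N%:R).

End RescaledDensity.

(** The labeled trees numbered 0, 1, ... are i.i.d. because the offspring numbers
    [K i u] and displacements [xi i u k] are independent over all indices; those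
    attached to words outside the [i]-th tree play no role. *)
Section RandomLabeledTrees.
Context {d : measure_display} {Omega : measurableType d} {R : realType}.
Variables (P : probability Omega R).
Variables (nu : probability nat R) (F : probability int R).
Variables (K : nat -> seq nat -> {RV P >-> nat}).
Variables (xi : nat -> seq nat -> nat -> {RV P >-> int}).

Definition generated_by_trees (e : nat * seq nat + nat * seq nat * nat) :
    set_system Omega :=
  match e with
  | inl (i, u) => generated_by (K i u)
  | inr (i, u, k) => generated_by (xi i u k)
  end.

Definition iid_labeled_trees :=
  [/\ forall i u (A : set nat), distribution P (K i u) A = nu A,
      forall i u k (A : set int), distribution P (xi i u k) A = F A
    & independent_systems P generated_by_trees].

Definition rescaled_densities (N : nat) (w : Omega) : cadlag (c0 R) :=
  rescaled_density R (fun i u => K i u w) (fun i u k => xi i u k w) N.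

Definition ordered_jumps_of_densities (N j : nat) (w : Omega) : c0 R :=
  ordered_jump R (fun i u => K i u w) (fun i u k => xi i u k w) N j.

End RandomLabeledTrees.

(* Main.v *)
From HB Require Import structures.
Require Import Defs.
From mathcomp Require Import all_boot all_order all_algebra.
From mathcomp Require Import finmap.
From mathcomp Require Import all_classical all_reals all_analysis.
From mathcomp Require Import measurable_realfun.
From mathcomp Require Import zify ring lra.

Set Implicit Arguments.
Unset Strict Implicit.
Unset Printing Implicit Defensive.

Import Order.TTheory GRing.Theory Num.Theory.
Import numFieldNormedType.Exports.

Local Open Scope classical_set_scope.
Local Open Scope ring_scope.

(** Convergence of the ordered jumps would follow from that of the paths by
    continuous mapping, if ranking the jumps were continuous on the Skorohod
    space. It is not: the area is not continuous for the supremum norm, because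
    mass may leave through infinity; a jump may cross time 1; and two jumps with
    nearly equal areas may exchange their ranks. The proof replaces [h] of the
    ordered jumps by a functional [ranked_inf] that is continuous everywhere and
    bounds it from below.

    Jumps are compared by their [score], the minimum of their area over the
    window [[-q, q]] and of [q ^ 2 * (1 - t)], which is Lipschitz in the jump and
    in its time [t]. For [h] with values in [[0, C]], [ranked_inf] is the infimum
    of [C] and of the values [h x + n * r], for all distinct times [t_0, t_1, ...]
    and all [x] such that [x_k] is within [r] of the jump at [t_k], and such that
    no time other than [t_j] with [j < k] scores more than [t_k] plus [r].
    - It is continuous ([ranked_inf_continuous]): nearby paths have nearly equal
      jumps at nearly equal times, so that admissible data for one path are
      admissible for the other with a slightly larger [r].
    - On a path of the limit it is nearly at least [h] of the ordered jumps
      ([ranked_inf_limit]): the term [n * r] forces [r] to be small, and as the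
      areas are strictly decreasing only the true times are then admissible.
    - On a path of the prelimit it is at most [h] of the ordered jumps plus
      [n * rho] ([ranked_inf_prelimit]), provided that no tree has an area
      exceeding its score by more than [rho]: the true times are admissible.

    The proviso holds with a probability close to 1 for [q] large, uniformly in
    [N] ([tree_score_bound]). Kolmogorov's estimate ([survival_le]) confines the
    first [N] trees to their first [h * N] generations. There, first moments are
    enough: each generation has mean size 1 ([mean_generation]), and the labels
    are far away with a probability bounded by Chebyshev's inequality, given the
    tree ([far_vertex_le]). Hence the vertices with labels of order at least
    [q * sqrt N] are few, the last [N / q] trees are small, and the total size is
    at most of order [q * N ^ 2].

    Letting [N], then [n] and [q] go to infinity gives
    [E h (J) <= liminf_N E h (J^N)] for all bounded continuous [h >= 0]
    ([mean_liminf]). For [`|h| <= M], this applied to [h + M] and to [M - h]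
    gives the convergence of the means.

    The tuples must also be random elements of the product. The ordered jumps of
    the prelimit are functions of finitely many lists of labels, hence discrete;
    those of the limit are handled by the separability of [c0 R]
    ([random_tuple], [tent_combination_dense]). *)

(** * Jumps of nearby paths *)

Section RankedFunctional.
Variables (R : realType) (V : normedModType R).

Lemma jump_le0 (y : cadlag V) t : t <= 0 -> jump y t = 0.
Proof.
case: y => y /= py; have /asboolP[y0 _ _] := py.
move=> t0; rewrite /jump /=; apply/eqP; rewrite subr_eq0; apply/eqP/esym.
apply: cvg_lim => //; apply: (@cvg_trans _ ((fun=> y t) @ t^'-)); last exact: cvg_cst.
apply: near_eq_cvg; near=> s; rewrite y0// [RHS]y0//.
by rewrite (le_trans _ t0)//; near: s; exact: nbhs_left_le.
Unshelve. all: by end_near. Qed.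

Lemma jump_cvg (y : cadlag V) t : y s @[s --> t^'-] --> y t - jump y t.
Proof.
case: y => y py; have /asboolP[_ _ yl] := py.
by rewrite /jump /= opprB addrC subrK; exact: yl.
Qed.

Lemma time_change0 lam : time_change lam -> lam 0 = 0 :> R.
Proof.
move=> [[lam0 _ lam_surj] lam_incr].
have [t /= t0 lt] := lam_surj 0 (lexx 0).
have := t0; rewrite le_eqVlt => /orP[/eqP t0'|t0']; first by rewrite {1}t0'.
have := lam_incr _ _ (lexx 0) t0'; rewrite lt ltNge.
by have /= -> := lam0 0 (lexx 0).
Qed.

(** A time change is increasing and onto, so that it cannot jump. *)
Lemma time_change_cvg_left (lam : R -> R) t : time_change lam -> 0 < t ->
  lam s @[s --> t^'-] --> (lam t)^'-.
Proof.
move=> lamP t0; have l0 := time_change0 lamP.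
have [[lam_ge0 _ lam_surj] lam_incr] := lamP.
have lt0 : 0 < lam t by rewrite -l0; exact: lam_incr.
move=> A [e /= e0 eA].
have [a [a0 ae alt]] : exists a, [/\ 0 <= a, lam t - e <= a & a < lam t].
  exists (Num.max 0 (lam t - e)); split; first by rewrite le_max lexx.
    by rewrite le_max lexx orbT.
  by rewrite gt_max lt0; lra.
have [s0 /= s00 ls0] := lam_surj a a0.
have s0t : s0 < t.
  rewrite ltNge; apply/negP; rewrite le_eqVlt => /orP[/eqP ts0|ts0].
    by move: ls0; rewrite -ts0; lra.
  by have := lam_incr _ _ (ltW t0) ts0; rewrite ls0; lra.
suff : \forall s \near t^'-, A (lam s) by [].
near=> s; have s0s : s0 < s by near: s; exact: nbhs_left_gt.
have st : s < t by near: s; exact: nbhs_left_lt.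
have lst : lam s < lam t by apply: lam_incr => //; lra.
have := lam_incr _ _ s00 s0s; rewrite ls0 => las.
by apply: eA => //=; rewrite gtr0_norm; lra.
Unshelve. all: by end_near. Qed.

(** The part of Skorohod closeness that concerns the jumps; unlike
    [skorohod_nbhs], it is stable under exchanging the two paths. *)
Definition jumps_match (y z : cadlag V) (T e : R) (u : R -> R) :=
  [/\ set_bij [set t | 0 <= t] [set t | 0 <= t] u, u 0 = 0,
      forall t, 0 <= t <= T -> `|u t - t| <= e /\ `|jump z (u t) - jump y t| <= e
    & forall t, 0 <= t -> T < t -> T - e < u t].

(** A jump is a difference of two values, each moved by at most [e]. *)
Lemma skorohod_jumps_match (y z : cadlag V) (T e : R) : 0 <= T ->
  skorohod_nbhs y T e z -> exists u, jumps_match y z T (2 * e) u.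
Proof.
move=> T0 [lam [lamP yz]]; exists lam.
have e0 : 0 < e.
  have [_ h] := yz 0 (introT andP (conj (lexx 0) T0)).
  exact: le_lt_trans h.
have l0 := time_change0 lamP.
have [lam_bij lam_incr] := lamP; split=> //.
- move=> t tT; have [lt zt] := yz t tT; split; first by lra.
  have /andP[t0 tT'] := tT.
  move: t0; rewrite le_eqVlt => /orP[/eqP t0|t0].
    by rewrite -t0 l0 !jump_le0// subr0 normr0; lra.
  have hz : z (lam s) @[s --> t^'-] --> z (lam t) - jump z (lam t).
    exact: (cvg_comp _ _ (time_change_cvg_left lamP t0) (jump_cvg (y := z) (t := lam t))).
  have hy := jump_cvg (y := y) (t := t).
  have hn : `|z (lam s) - y s| @[s --> t^'-] -->
      `|z (lam t) - jump z (lam t) - (y t - jump y t)|.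
    by apply: cvg_norm; exact: cvgB.
  have le_e : `|z (lam t) - jump z (lam t) - (y t - jump y t)| <= e.
    rewrite -(cvg_lim _ hn)//; apply: limr_le; first by apply/cvg_ex; eexists; exact: hn.
    near=> s; apply: ltW.
    have s0 : 0 < s by near: s; exact: nbhs_left_gt.
    have st : s < t by near: s; exact: nbhs_left_lt.
    by have /= [_] := yz s (introT andP (conj (ltW s0) (le_trans (ltW st) tT'))).
  have -> : jump z (lam t) - jump y t =
      (z (lam t) - y t) - (z (lam t) - jump z (lam t) - (y t - jump y t)).
    by rewrite (opprB (_ - _) (_ - _)) [RHS]addrA subrKA (opprB (z _)) [RHS]addrC subrKA.
  apply: (le_trans (ler_normB _ _)); lra.
- move=> t t0 Tt; have [lT _] := yz T (introT andP (conj T0 (lexx T))).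
  have := lam_incr _ _ T0 Tt; move: lT; rewrite ltr_norml; lra.
Unshelve. all: by end_near. Qed.

(** The inverse of a matching is a matching, at the cost of the last [e] units of
    time. This is what makes one inequality sufficient for continuity. *)
Lemma jumps_match_sym (y z : cadlag V) (T e : R) u : 0 <= e ->
  jumps_match y z T e u -> exists v, jumps_match z y (T - e) e v.
Proof.
move=> e0 [[u_ge0 u_inj u_surj] u0 uT uT'].
have /choice[v vP] : forall s, exists t, 0 <= s -> 0 <= t /\ u t = s.
  move=> s; have [s0|s0] := leP 0 s; last by exists 0.
  by have [t /= t0 us] := u_surj s s0; exists t.
exists v.
have vu t : 0 <= t -> v (u t) = t.
  move=> t0; have [vt0 uv] := vP (u t) (u_ge0 _ t0).
  by apply: u_inj; rewrite ?inE.
split.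
- split.
  + by move=> s /= s0; have [] := vP s s0.
  + move=> s s' /[!inE]/= s0 s'0 vss'.
    by have [_ <-] := vP s s0; rewrite vss'; have [_ ->] := vP s' s'0.
  + by move=> t /= t0; exists (u t); [exact: u_ge0|exact: vu].
- by rewrite -u0 vu ?u0.
- move=> s /andP[s0 sT]; have [t0 us] := vP s s0.
  have tT : v s <= T by rewrite leNgt; apply/negP => /(uT' _ t0); lra.
  have := uT (v s); rewrite t0 tT us => /(_ isT)[? ?].
  by rewrite distrC; split=> //; rewrite distrC.
- move=> s s0 sT; have [t0 us] := vP s s0.
  rewrite ltNge; apply/negP => tT.
  have := uT (v s); rewrite t0 us (_ : v s <= T); last by lra.
  by move=> /(_ isT)[]; rewrite ler_norml; lra.
Qed.

(** * The ranking functional *)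

Variables (m : nat) (b : V -> R) (L a n C : R) (h : ('I_m -> V) -> R).
Hypothesis b0 : b 0 = 0.
Hypothesis b_lip : forall x y, `|b x - b y| <= L * `|x - y|.
Hypotheses (L0 : 0 <= L) (a0 : 0 < a) (n0 : 0 < n) (C0 : 0 <= C).
Hypothesis h0 : forall x, 0 <= h x.

(** The second term makes the relevance of a jump fade out continuously before
    time 1, after which jumps are not ranked. *)
Definition score (y : cadlag V) (t : R) : R :=
  Num.min (b (jump y t)) (a * (1 - t)).

(** Time 0 never jumps and scores 0. Admitting it as a competitor for every rank
    forces all chosen times to score at least [- r], hence to be bounded. *)
Definition nearly_ranked (y : cadlag V) (t : 'I_m -> R) (r : R) :=
  forall (k : 'I_m) (s : R), 0 <= s ->
    (s = 0 \/ forall j : 'I_m, (j < k)%N -> t j <> s) ->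
  score y s <= score y (t k) + r.

(** The value [C] is always admitted, so that data with [C <= n * r], for which
    the times would not be controlled, do not affect the infimum. *)
Definition ranked_values (y : cadlag V) : set R := [set c | c = C \/
  exists (t : 'I_m -> R) (x : 'I_m -> V) (r : R),
    0 <= r /\ [/\ injective t, forall k, 0 <= t k, nearly_ranked y t r,
                  forall k, `|x k - jump y (t k)| <= r & c = h x + n * r]].

Definition ranked_inf (y : cadlag V) : R := inf (ranked_values y).

Lemma ranked_values_ge0 y c : ranked_values y c -> 0 <= c.
Proof.
move=> [->//|[t [x [r [r0 [_ _ _ _ ->]]]]]].
by rewrite addr_ge0// mulr_ge0// ltW.
Qed.

Lemma has_inf_ranked_values y : has_inf (ranked_values y).
Proof.
by split; [exists C; left|exists 0 => c; exact: ranked_values_ge0].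
Qed.

Lemma ranked_inf_le y c : ranked_values y c -> ranked_inf y <= c.
Proof. by apply: ge_inf; have [] := has_inf_ranked_values y. Qed.

Lemma ranked_inf_ge y c :
  (forall c', ranked_values y c' -> c <= c') -> c <= ranked_inf y.
Proof. by move=> cP; apply: lb_le_inf => //; exists C; left. Qed.

Lemma ranked_inf_ge0 y : 0 <= ranked_inf y.
Proof. by apply: ranked_inf_ge => c; exact: ranked_values_ge0. Qed.

Lemma ranked_inf_leC y : ranked_inf y <= C.
Proof. by apply: ranked_inf_le; left. Qed.

Lemma score0 y : score y 0 = Num.min 0 a.
Proof. by rewrite /score jump_le0// b0 subr0 mulr1. Qed.

Lemma score_match (y z : cadlag V) T e u t : jumps_match y z T e u ->
  0 <= t <= T -> `|score z (u t) - score y t| <= (L + a) * e.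
Proof.
move=> [_ _ uT _] tT; have [ut jt] := uT t tT.
have bl : `|b (jump z (u t)) - b (jump y t)| <= L * e.
  by apply: (le_trans (b_lip _ _)); rewrite ler_wpM2l.
have al : `|a * (1 - u t) - a * (1 - t)| <= a * e.
  rewrite -mulrBr normrM gtr0_norm// ler_pM2l//.
  by rewrite (_ : 1 - u t - _ = - (u t - t)) ?normrN//; ring.
have Le : 0 <= L * e by apply: le_trans bl.
have ae : 0 <= a * e by apply: le_trans al.
move: bl al; rewrite !ler_norml /score mulrDl.
move: (b (jump z _)) (b (jump y _)) (a * (1 - u t)) (a * (1 - t)) => b1 b2 a1 a2.
by rewrite !minEle; case: ifPn => ?; case: ifPn => ?; lra.
Qed.

(** A matching of the jumps transports the admissible data for [y] to [z] at a
    cost proportional to [e]. Times beyond [T] are harmless: in the list they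
    are penalized, and as competitors they score below the jump at time 0. *)
Lemma ranked_inf_match (y z : cadlag V) T e u : 0 <= e -> e <= 1 ->
  1 + C / (n * a) + 1 <= T -> jumps_match y z T e u ->
  ranked_inf z <= ranked_inf y + n * (2 * (L + a) + 1) * e.
Proof.
move=> e0 e1 CT yz; rewrite -lerBlDr; apply: ranked_inf_ge => c.
have Ca : 0 <= C / (n * a) by rewrite divr_ge0// mulr_ge0// ltW.
have Lae : 0 <= (L + a) * e by rewrite mulr_ge0// addr_ge0// ltW.
have ne : 0 <= n * (2 * (L + a) + 1) * e.
  by rewrite !mulr_ge0 ?(ltW n0)// addr_ge0// mulr_ge0// addr_ge0// ltW.
have [uB u0 uT uT'] := yz; have [u_ge0 u_inj u_surj] := uB.
move=> [->|]; first by have := ranked_inf_leC z; lra.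
move=> [t [x [r [r0 [t_inj t_ge0 tr xr cE]]]]].
have [cC|Cc] := ltP c C; last by have := ranked_inf_leC z; lra.
rewrite lerBlDr.
(* The competitor 0 prevents late times, as [n * r] is at most [C]. *)
have tk_ge k : - r <= score y (t k).
  have := tr k 0 (lexx 0) (or_introl erefl); rewrite score0 min_l ?(ltW a0)//; lra.
have tT k : t k <= T.
  have : - r <= a * (1 - t k) by apply: (le_trans (tk_ge k)); rewrite ge_min lexx orbT.
  have rC : r <= C / n by rewrite ler_pdivlMr// mulrC; have := h0 x; lra.
  have : C / (n * a) * a = C / n by rewrite invfM mulrA divfK// gt_eqF.
  move=> Cna; rewrite mulrBr mulr1 => tka.
  have : a * t k <= a * (1 + C / (n * a)) by rewrite mulrDr mulr1 [a * (C / _)]mulrC Cna; move: (C / n) rC tka => Cn ? ?; lra.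
  by rewrite ler_pM2l//; lra.
have tkT k : 0 <= t k <= T by rewrite t_ge0 tT.
apply: (@le_trans _ _ (h x + n * (r + (2 * (L + a) + 1) * e))); last by rewrite cE; lra.
apply: ranked_inf_le; right; exists (u \o t), x, (r + (2 * (L + a) + 1) * e).
split; last split => //.
- by move: Lae; lra.
- by move=> i j /= uij; apply: t_inj; apply: u_inj => //; rewrite inE /=.
- by move=> k; exact: u_ge0 (t_ge0 k).
- move=> k s' s'0 hs'; have [s /= s0 us] := u_surj s' s'0.
  have := score_match yz (tkT k); rewrite ler_norml => hk.
  have hs : s = 0 \/ forall j : 'I_m, (j < k)%N -> t j <> s.
    case: hs' => [s'E|hs']; [left|right].
      by apply: u_inj; rewrite ?inE//= u0 us.
    by move=> j jk tjs; apply: (hs' j jk); rewrite /= tjs.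
  (* The competitor [s'] for [z] is the image of [s]; if [s] is beyond [T], then
     [s'] is late and scores at most 0. *)
  have [sT|Ts] := leP s T.
    have := @score_match y z T e u s yz; rewrite s0 sT => /(_ isT).
    rewrite us ler_norml /=; have := tr k s s0 hs; move: hk => /=; lra.
  apply: (@le_trans _ _ 0); last by have := tk_ge k; move: hk => /=; lra.
  rewrite /score ge_min; apply/orP; right; rewrite pmulr_rle0//.
  have := uT' s s0 Ts; rewrite us; lra.
- move=> k /=; have [_ jk] := uT _ (tkT k).
  apply: (le_trans (ler_distD (jump y (t k)) _ _)); have := xr k.
  rewrite (distrC (jump y _) (jump z _)); move: jk; lra.
Qed.

(** [ranked_inf_match] holds for the matching of the jumps and for its inverse,
    and its cost tends to 0. *)
Lemma ranked_inf_continuous : continuous ranked_inf.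
Proof.
apply/continuousP => B oB; rewrite /open/= => y /= yB.
have /nbhs_ballP[e /= e0 eB] := open_nbhs_nbhs (conj oB yB).
have Ca : 0 <= C / (n * a) by rewrite divr_ge0// mulr_ge0// ltW.
pose K := n * (2 * (L + a) + 1).
have K0 : 0 < K by rewrite mulr_gt0// ltr_wpDl// mulr_ge0// addr_ge0// ltW.
pose d := Num.min 1 (e / (2 * K)).
have d0 : 0 < d by rewrite lt_min ltr01 divr_gt0// mulr_gt0.
have d1 : d <= 1 by rewrite ge_min lexx.
have dK : K * d < e.
  apply: (@le_lt_trans _ _ (e / 2)); last by lra.
  rewrite mulrC -ler_pdivlMr// -mulrA -invfM ge_min.
  by rewrite lexx orbT.
pose T := 1 + C / (n * a) + 1.
exists (T + 1), (d / 2); split; first by rewrite divr_gt0.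
move=> z yz; apply: eB.
have T0 : 0 <= T + 1 by rewrite /T; lra.
have [u yzu] := skorohod_jumps_match T0 yz.
rewrite mulrCA divff ?mulr1// in yzu.
have [v zyv] := jumps_match_sym (ltW d0) yzu.
have h1 : ranked_inf z <= ranked_inf y + K * d.
  by apply: (ranked_inf_match (ltW d0) d1 _ yzu); rewrite /T; lra.
have h2 : ranked_inf y <= ranked_inf z + K * d.
  by apply: (ranked_inf_match (ltW d0) d1 _ zyv); rewrite /T; lra.
by rewrite /ball/= ltr_norml; lra.
Qed.

End RankedFunctional.

(** * Areas over a window *)

Section WindowArea.
Variable R : realType.
Implicit Types (f g : c0 R) (q : nat).
Local Notation mu := (@lebesgue_measure R).

Definition window q : set (measurableTypeR R) := `[- q%:R, q%:R].

(** Unlike the area over the whole line, this is continuous for the norm. *)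
Definition window_area q f : R := \int[mu]_(x in window q) f x.

Lemma c0B f g x : (f - g) x = f x - g x.
Proof. by []. Qed.

Lemma c0Z (r : R) f x : (r *: f) x = r * f x.
Proof. by []. Qed.

Lemma c0_sum (I : Type) (s : seq I) (F : I -> c0 R) x :
  (\sum_(i <- s) F i) x = \sum_(i <- s) F i x.
Proof.
elim: s => [|i s IH]; first by rewrite !big_nil.
by rewrite !big_cons -IH.
Qed.

Lemma c0_continuous f : continuous f.
Proof. by have [] := c0P f. Qed.

Lemma measurable_c0 f : measurable_fun [set: measurableTypeR R] (fun x : R => (f x)%:E).
Proof.
by apply/measurable_EFinP; apply: continuous_measurable_fun; exact: c0_continuous.
Qed.

Lemma window_integrable q f : mu.-integrable (window q) (EFin \o f).
Proof.
apply: continuous_compact_integrable; first exact: segment_compact.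
by apply: continuous_subspaceT; exact: c0_continuous.
Qed.

Lemma measurable_window q : measurable (window q).
Proof. exact: measurable_itv. Qed.

Lemma window_areaD q f g : window_area q (f + g) = window_area q f + window_area q g.
Proof.
rewrite /window_area -RintegralD//;
  [exact: measurable_window|exact: window_integrable..].
Qed.

Lemma window_areaZ q (r : R) f : window_area q (r *: f) = r * window_area q f.
Proof. by rewrite /window_area -RintegralZl//;
  [exact: measurable_window|exact: window_integrable]. Qed.

Lemma window_area0 q : window_area q 0 = 0.
Proof. by rewrite -(scale0r (0 : c0 R)) window_areaZ mul0r. Qed.

Lemma window_areaB q f g : window_area q (f - g) = window_area q f - window_area q g.
Proof. by rewrite -scaleN1r window_areaD window_areaZ mulN1r. Qed.

Lemma window_area_sum q (I : Type) (s : seq I) (F : I -> c0 R) :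
  window_area q (\sum_(i <- s) F i) = \sum_(i <- s) window_area q (F i).
Proof.
elim: s => [|i s IH]; first by rewrite !big_nil window_area0.
by rewrite !big_cons window_areaD IH.
Qed.

Lemma window_measure q : mu (window q) = (2 * q%:R)%:E.
Proof.
rewrite /window lebesgue_measure_itv /= lte_fin.
have [->|q0] := posnP q; first by rewrite oppr0 ltxx mulr0.
by rewrite ifT ?EFinN -?EFinB; [congr EFin; lra|rewrite gtrN ?ltr0n].
Qed.

Lemma window_area_norm q f : `|window_area q f| <= 2 * q%:R * `|f|.
Proof.
rewrite /window_area; apply: (le_trans (le_normr_Rintegral (measurable_window q) (window_integrable q f))).
have <- : \int[mu]_(x in window q) `|f| = 2 * q%:R * `|f|.
  rewrite Rintegral_cst; last exact: measurable_window.
  by rewrite [X in fine X]window_measure mulrC.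
apply: le_Rintegral; first exact: measurable_window.
- apply: integrable_norm (window_integrable q f); exact: measurable_window.
- apply/integrableP; split; first exact: measurable_cst.
  rewrite integral_cst/=; last exact: measurable_window.
  by rewrite [X in (_ * X)%E]window_measure -EFinM ltry.
- by move=> x _; exact: c0_norm_ub.
Qed.

Lemma window_area_lip q f g :
  `|window_area q f - window_area q g| <= 2 * q%:R * `|f - g|.
Proof. by rewrite -window_areaB window_area_norm. Qed.

Lemma window_areaE q f : (window_area q f)%:E = (\int[mu]_(x in window q) (f x)%:E)%E.
Proof. by rewrite fineK//; apply: integrable_fin_num (window_integrable q f); exact: measurable_window. Qed.

Lemma window_area_le q f : (forall x, 0 <= f x) ->
  ((window_area q f)%:E <= \int[mu]_x (f x)%:E)%E.
Proof.
move=> f0; rewrite window_areaE; apply: ge0_subset_integral => //.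
- exact: measurable_window.
- exact: measurable_c0.
- by move=> x _; rewrite lee_fin.
Qed.

(** Monotone convergence; the area on the right may be infinite. *)
Lemma window_area_eventually_gt f (c : R) : (forall x, 0 <= f x) ->
  (c%:E < \int[mu]_x (f x)%:E)%E -> \forall q \near \oo, c < window_area q f.
Proof.
move=> f0 cf.
have : ((\int[mu]_(x in window q) (f x)%:E) @[q --> \oo] -->
    \int[mu]_(x in \bigcup_q window q) (f x)%:E)%E.
  apply: ge0_nondecreasing_set_cvg_integral => //.
  - apply/nondecreasing_seqP => q; rewrite subsetEset => x.
    rewrite /window /= !in_itv /= => /andP[xq qx]; apply/andP; split.
      by apply: le_trans xq; rewrite lerN2 ler_nat.
    by apply: (le_trans qx); rewrite ler_nat.
  - by move=> q; exact: measurable_window.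
  - by move=> q; apply: (measurable_funS measurableT _ (measurable_c0 f)).
  - by move=> q x _; rewrite lee_fin.
rewrite bigcup_itvT => /(_ _ (open_ereal_gt' cf)) near_q.
have {}near_q : \forall q \near \oo, (c%:E < \int[mu]_(x in window q) (f x)%:E)%E.
  exact: near_q.
by near=> q; rewrite -lte_fin window_areaE; near: q.
Unshelve. all: by end_near.
Qed.

(** * Tents *)

(** This is the function [max 0 (1 - `|x|)]. *)
Definition unit_tent (x : R) : R :=
  linear_interpolation (fun j : int => ((0 : int) == j)%:R) x.

Lemma linear_interpolation_delta (l : int) (x : R) :
  linear_interpolation (fun j => (l == j)%:R) x = unit_tent (x - l%:~R).
Proof.
have fE : Num.floor (x - l%:~R) = Num.floor x - l.
  apply: floor_def; have := floor_itv x; rewrite !intrD !mulrNz mulr1z => /andP[? ?].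
  by apply/andP; split; lra.
rewrite /unit_tent /linear_interpolation fE intrB.
have -> : (0 == Num.floor x - l) = (l == Num.floor x) by lia.
have -> : (0 == Num.floor x - l + 1) = (l == Num.floor x + 1) by lia.
have -> // : x - l%:~R - ((Num.floor x)%:~R - l%:~R) = x - (Num.floor x)%:~R by ring.
Qed.

Lemma unit_tent_ge0 x : 0 <= unit_tent x.
Proof.
rewrite /unit_tent /linear_interpolation; have := floor_itv x; rewrite intrD.
by move=> /andP[? ?]; rewrite addr_ge0// mulr_ge0//; lra.
Qed.

Lemma unit_tent_le1 x : unit_tent x <= 1.
Proof.
rewrite /unit_tent /linear_interpolation; have := floor_itv x; rewrite intrD.
by move=> /andP[? ?]; do 2 case: (_ == _); rewrite /= ?mulr1 ?mulr0; lra.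
Qed.

Lemma unit_tent_out x : 1 <= `|x| -> unit_tent x = 0.
Proof.
move=> x1; rewrite /unit_tent /linear_interpolation.
have := floor_itv x; rewrite intrD => /andP[fx xf].
have [f0|f0] := eqVneq 0 (Num.floor x).
  by move: x1 xf fx; rewrite -f0 ler_normr; lra.
have [f1|f1] := eqVneq 0 (Num.floor x + 1); last by rewrite !mulr0 addr0.
have fE : Num.floor x = -1 by lia.
by move: x1 xf fx; rewrite fE ler_normr mulrNz mulr1z mulr0 mulr1 => *; lra.
Qed.

Section Tent.
Variables (a : R) (a0 : 0 < a).

(** With [a = sqrt N], and up to a constant factor, the contribution of a vertex
    of label [l] to the rescaled density. *)
Definition tent (l : int) : c0 R :=
  MkC0 (interpolation_vanishing [:: l] id a0).

Lemma tentE l x : tent l x = unit_tent (a * x - l%:~R).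
Proof.
rewrite -linear_interpolation_delta /= /linear_interpolation.
by rewrite !addn0.
Qed.

Lemma tent_ge0 l x : 0 <= tent l x.
Proof. by rewrite tentE unit_tent_ge0. Qed.

End Tent.

Lemma unit_tent_continuous : continuous unit_tent.
Proof.
have -> : unit_tent = tent ltr01 0; last exact: c0_continuous.
by apply/funext => x; rewrite tentE mul1r subr0.
Qed.

Definition unit_tent_area : R := fine (\int[mu]_x (unit_tent x)%:E)%E.

(** Comparison with the indicator of the support. *)
Lemma unit_tent_areaE : (unit_tent_area%:E = \int[mu]_x (unit_tent x)%:E)%E
  /\ 0 <= unit_tent_area <= 2.
Proof.
have mt : measurable_fun [set: measurableTypeR R] (fun x => (unit_tent x)%:E).
  by apply/measurable_EFinP; apply: continuous_measurable_fun; exact: unit_tent_continuous.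
have le2 : (\int[mu]_x (unit_tent x)%:E <= 2%:E)%E.
  apply: (@le_trans _ _ (\int[mu]_x (\1_(window 1) x)%:E)%E).
    apply: ge0_le_integral => //.
    - by move=> x _; rewrite lee_fin unit_tent_ge0.
    - apply/measurable_EFinP; exact: measurable_indic (measurable_window 1).
    - move=> x _; rewrite lee_fin indicE.
      have [xw|xw] := boolP (x \in window 1); first exact: unit_tent_le1.
      rewrite unit_tent_out//; move: xw; rewrite /window notin_setE /= in_itv /=.
      move=> /negP; rewrite negb_and -!ltNge => /orP[?|?].
        by rewrite ler_normr; apply/orP; right; lra.
      by rewrite ler_normr; apply/orP; left; lra.
  rewrite integral_indic//; last exact: measurable_window.
  by rewrite setIT [X in (X <= _)%E]window_measure mulr1.
have ge0 : (0 <= \int[mu]_x (unit_tent x)%:E)%E.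
  by apply: integral_ge0 => x _; rewrite lee_fin unit_tent_ge0.
have fin : (\int[mu]_x (unit_tent x)%:E)%E \is a fin_num.
  by rewrite ge0_fin_numE// (le_lt_trans le2) ?ltry.
by rewrite fineK//; split=> //; rewrite fine_ge0//= -lee_fin fineK.
Qed.

Section TentArea.
Variables (a : R) (a0 : 0 < a).

Lemma tent_integral l :
  (\int[mu]_x (tent a0 l x)%:E = (unit_tent_area / a)%:E)%E.
Proof.
have [cE _] := unit_tent_areaE.
have dF (x : R) : is_derive x 1 (a \*: (@id R) - cst (l%:~R : R)) a.
  by apply: is_derive_eq; rewrite subr0 /GRing.scale /= mulr1.
have FE : a \*: (@id R) - cst (l%:~R : R) = (fun x => a * x - l%:~R) by apply/funext.
rewrite FE in dF.
have dFE : derive1 (fun y : R => a * y - l%:~R) = cst a.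
  by apply/funext => x; rewrite derive1E; have := dF x => d; exact: derive_val.
have mt : measurable_fun [set: measurableTypeR R] (fun x => (tent a0 l x)%:E).
  exact: measurable_c0.
have : (unit_tent_area%:E = a%:E * \int[mu]_x (tent a0 l x)%:E)%E.
  rewrite cE (@increasing_ge0_integration_by_substitutionT R (fun x => a * x - l%:~R) unit_tent).
  - rewrite dFE -ge0_integralZl_EFin//; last exact: ltW.
      by apply: eq_integral => x _; rewrite tentE -EFinM mulrC.
    by move=> x _; rewrite lee_fin tent_ge0.
  - by move=> x y xy; rewrite ltrD2r ltr_pM2l.
  - by rewrite dFE => x; exact: cvg_cst.
  - by rewrite dFE; exact: is_cvg_cst.
  - by rewrite dFE; exact: is_cvg_cst.
  - by move=> x; have [] := dF x.
  - apply/cvgrNyPle => A; near=> x.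
    have : x <= (A + l%:~R) / a by near: x; apply: nbhs_ninfty_le; exact: num_real.
    by rewrite ler_pdivlMr// mulrC; lra.
  - apply/cvgryPge => A; near=> x.
    have : (A + l%:~R) / a <= x by near: x; apply: nbhs_pinfty_ge; exact: num_real.
    by rewrite ler_pdivrMr// mulrC; lra.
  - exact: unit_tent_continuous.
  - exact: unit_tent_ge0.
move=> h; rewrite mulrC EFinM h muleA -EFinM mulVf ?mul1e//; exact: lt0r_neq0.
Unshelve. all: by end_near. Qed.

Lemma window_tent_le q l : window_area q (tent a0 l) <= unit_tent_area / a.
Proof.
rewrite -lee_fin -(tent_integral l); apply: window_area_le => x; exact: tent_ge0.
Qed.

(** The support of the tent then lies in the window. *)
Lemma window_tent_eq q l : `|l%:~R| + 1 <= a * q%:R ->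
  window_area q (tent a0 l) = unit_tent_area / a.
Proof.
move=> lq; apply: EFin_inj; rewrite -(tent_integral l) window_areaE.
rewrite [LHS]integral_mkcond; apply: eq_integral => x _; rewrite patchE.
case: ifPn => // xw; rewrite tentE unit_tent_out//.
move: xw; rewrite /window notin_setE /= in_itv /= => /negP.
rewrite negb_and -!ltNge => /orP[xq|qx].
  rewrite -normrN ler_normr; apply/orP; left.
  have : a * x < a * - q%:R by rewrite ltr_pM2l.
  have := ler_norm (- l%:~R : R); rewrite normrN; lra.
rewrite ler_normr; apply/orP; left.
have : a * q%:R < a * x by rewrite ltr_pM2l.
have := ler_norm (l%:~R : R); lra.
Qed.

End TentArea.

End WindowArea.

(** * The ranking functional of the limit *)

Section RankedLimit.
Variable R : realType.
Local Notation mu := (@lebesgue_measure R).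

Lemma jump_ge0 (y : cadlag (c0 R)) :
  (forall s t x, 0 <= s -> s <= t -> y s x <= y t x) ->
  forall t, 0 < t -> forall x, 0 <= jump y t x.
Proof.
move=> y_mono t t0 x; have := jump_cvg (y := y) (t := t).
set l := y t - jump y t => yl.
have lE : jump y t x = y t x - l x.
  by rewrite /l [in RHS]c0B; ring.
have ylx : y s x @[s --> t^'-] --> l x.
  apply/cvgrPdist_lt => e e0; move/cvgrPdist_lt : yl => /(_ e e0).
  apply: filterS => s; apply: le_lt_trans; exact: (c0_norm_ub (l - y s)).
rewrite lE subr_ge0 -(cvg_lim _ ylx)//; apply: limr_le.
  by apply/cvg_ex; exists (l x).
near=> s; apply: y_mono; last by near: s; exact: nbhs_left_le.
by near: s; exact: nbhs_left_ge.
Unshelve. all: by end_near. Qed.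

Variables (m : nat) (C : R) (h : ('I_m -> c0 R) -> R).
Hypothesis hC : forall x, h x <= C.
Hypothesis h0 : forall x, 0 <= h x.

(** For [n] large, the score of the true time of rank [k] exceeds by more than
    [C / n] the area of the next jump. Admissible data satisfy [n * r <= C], or
    else are worth at least [C]; so by induction on [k] the chosen time of rank
    [k] must be the true one, every other time left scoring too little. *)
Lemma ranked_inf_limit (y : cadlag (c0 R)) (j : nat -> c0 R) (e : R) : 0 < e ->
  (forall s t x, 0 <= s -> s <= t -> y s x <= y t x) ->
  ordered_jumps y j ->
  (exists2 d, 0 < d & forall x : 'I_m -> c0 R, (forall k, `|x k - j k| < d) ->
     h j - e < h x) ->
  \forall n \near \oo, forall q, (n <= q)%N ->
    h j - e <= ranked_inf (window_area q) (q%:R ^+ 2) n%:R C h y.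
Proof.
move=> e0 y_mono [tau [tau_inj tau_range jE j_decr]] [d d0 hd].
have tau01 k : 0 < tau k < 1 by have [] : [set t | 0 < t < 1 /\ jump y t <> 0] (tau k) by rewrite -tau_range; exists k.
have j_ge0 k x : 0 <= j k x.
  by rewrite jE; apply: jump_ge0 => //; have /andP[] := tau01 k.
pose area (k : nat) := (\int[mu]_x (j k x)%:E)%E.
have area_ge0 k : (0 <= area k)%E.
  by apply: integral_ge0 => x _; rewrite lee_fin.
have area_decr i k : (i <= k)%N -> (area k <= area i)%E.
  move=> /subnK <-; elim: (k - i)%N => [//|p IH].
  by rewrite addSn (le_trans _ IH)// ltW//; exact: j_decr.
have area_fin k : area k.+1 \is a fin_num.
  by rewrite ge0_fin_numE// (lt_le_trans (j_decr k))// leey.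
have C0 : 0 <= C by apply: le_trans (hC j).
have small (c : R) : 0 < c -> \forall n \near \oo, C / n%:R < c.
  move=> c0; near=> n.
  have n0 : 0 < n%:R :> R by rewrite ltr0n; near: n; exact: nbhs_infty_gt.
  rewrite ltr_pdivrMr// -ltr_pdivrMl//.
  by near: n; exact: nbhs_infty_gtr.
(* A real [c] separates the two areas even if the larger one is infinite. *)
have sep (k : 'I_m) : exists2 c : R, fine (area k.+1) < c &
    \forall q \near \oo, c < score (window_area q) (q%:R ^+ 2) y (tau k).
  have [c [kc ck]] : exists c : R, fine (area k.+1) < c /\ (c%:E < area k)%E.
    have := j_decr k; rewrite -/(area k) -/(area k.+1) -(fineK (area_fin k)) /=.
    move: (fine _) (area k) => A [B|_|//].
      by rewrite lte_fin => AB; exists ((A + B) / 2); split; [|rewrite lte_fin]; lra.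
    by exists (A + 1); rewrite ltry; split => //; lra.
  exists c => //; near=> q; rewrite /score lt_min -jE; apply/andP; split.
    by near: q; exact: window_area_eventually_gt.
  have /andP[_ tau1] := tau01 k.
  have q1 : 1 <= q%:R :> R by rewrite ler1n; near: q; exact: nbhs_infty_gt.
  have : c / (1 - tau k) < q%:R by near: q; exact: nbhs_infty_gtr.
  rewrite ltr_pdivrMr ?subr_gt0// => /lt_le_trans; apply.
  by rewrite ler_pM2r ?subr_gt0// expr2 ler_peMl// (le_trans _ q1).
have sepQ (k : 'I_m) : \forall n \near \oo, forall q, (n <= q)%N ->
    fine (area k.+1) + C / n%:R < score (window_area q) (q%:R ^+ 2) y (tau k).
  have [c kc [Q _ cQ]] := sep k.
  near=> n => q nq; apply: (@lt_trans _ _ c).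
    rewrite addrC -ltrBrDr; near: n; apply: small; lra.
  apply: cQ => /=; apply: leq_trans nq; near: n; exact: nbhs_infty_ge.
near=> n => q nq.
have n0 : 0 < n%:R :> R by rewrite ltr0n; near: n; exact: nbhs_infty_gt.
have q0 : 0 < q%:R :> R by rewrite (lt_le_trans n0)// ler_nat.
have sepn : forall (k : 'I_m) q, (n <= q)%N ->
    fine (area k.+1) + C / n%:R < score (window_area q) (q%:R ^+ 2) y (tau k).
  by near: n; exact: filter_forall.
have Cd : C / n%:R < d by near: n; exact: small.
apply: ranked_inf_ge => c [->|[t [x [r [r0 [t_inj t0 tr xr ->]]]]]].
  by have := hC j; lra.
have [rC|rC] := leP (n%:R * r) C; last first.
  by have := hC j; have := h0 x; lra.
have {}rC : r <= C / n%:R by rewrite ler_pdivlMr// mulrC.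
(* Data with [n * r > C] being excluded, the times are the true ones. *)
have tE (k : 'I_m) : t k = tau k.
  have [i ik] := ubnP (val k); elim: i k ik => // i IH k; rewrite ltnS => ki.
  have {}IH (l : 'I_m) : (l < k)%N -> t l = tau l by move=> lk; apply: IH; exact: leq_trans ki.
  have [tau0 tau1] := andP (tau01 k).
  have st : score (window_area q) (q%:R ^+ 2) y (tau k) <=
      score (window_area q) (q%:R ^+ 2) y (t k) + r.
    apply: tr; first exact: ltW.
    by right => l lk; rewrite IH// => /tau_inj /eqP; rewrite ltn_eqF.
  apply: contrapT => tk.
  have := sepn k q nq; suff : score (window_area q) (q%:R ^+ 2) y (t k) <= fine (area k.+1) by lra.
  have area0 : 0 <= fine (area k.+1) by exact: fine_ge0.
  have [tk1|tk1] := leP 1 (t k).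
    apply: (le_trans _ area0); rewrite /score ge_min; apply/orP; right.
    by rewrite mulr_ge0_le0// ?subr_le0// exprn_ge0// ltW.
  have [jt|jt] := eqVneq (jump y (t k)) 0.
    apply: (le_trans _ area0); rewrite /score ge_min; apply/orP; left.
    by rewrite jt window_area0.
  have tk0 : 0 < t k.
    by rewrite lt_neqAle t0 andbT; apply: contra_neq jt => <-; exact: jump_le0.
  have [p _ it] : [set tau i | i in [set: nat]] (t k).
    by rewrite tau_range /= tk0 tk1; split=> //; exact/eqP.
  have kp : (k < p)%N.
    rewrite ltnNge; apply/negP; rewrite leq_eqVlt => /orP[/eqP ik|ik].
      by apply: tk; rewrite -it ik.
    have im : (p < m)%N by apply: ltn_trans (ltn_ord k).
    have := IH (Ordinal im) ik; rewrite /= it => /t_inj/(congr1 val)/= ik'.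
    by rewrite ik' ltnn in ik.
  rewrite /score ge_min; apply/orP; left.
  rewrite -lee_fin (fineK (area_fin k)).
  apply: (le_trans _ (area_decr _ _ kp)).
  by rewrite -it -jE; exact: window_area_le.
have /ltW : h j - e < h x.
  apply: hd => k; apply: le_lt_trans Cd; apply: (le_trans _ rC).
  by rewrite jE -tE.
move=> /le_trans; apply.
by rewrite lerDl mulr_ge0// ltW.
Unshelve. all: by end_near. Qed.
End RankedLimit.

(** * Independence of disjoint blocks *)

Section BlockIndependence.
Context {d : measure_display} {Omega : measurableType d} {R : realType}.
Variables (P : probability Omega R) (I : choiceType) (E : I -> set_system Omega).
Hypothesis ET : forall i, E i setT.
Hypothesis EI : forall i, setI_closed (E i).
Hypothesis EM : forall i, E i `<=` measurable.
Hypothesis Eindep : independent_systems P E.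
Local Open Scope ereal_scope.

Definition cylinders (B : set I) : set_system Omega := [set A |
  exists (s : {fset I}) (f : I -> set Omega), [/\ forall i, i \in s -> B i,
    forall i, i \in s -> E i (f i) & A = \bigcap_(i in [set` s]) f i]].

Definition block (B : set I) : set_system Omega := <<s cylinders B >>.

Lemma cylinder_measurable B : cylinders B `<=` measurable.
Proof.
move=> _ [s [f [_ Ef ->]]]; apply: fin_bigcap_measurable.
  exact: finite_fset.
by move=> i /Ef; exact: EM.
Qed.

Lemma cylinders_setI B : setI_closed (cylinders B).
Proof.
move=> _ _ [s [f [sB Ef ->]]] [s' [f' [s'B Ef' ->]]].
exists (s `|` s')%fset, (fun i => (if i \in s then f i else setT) `&`
                             (if i \in s' then f' i else setT)); split.
- by move=> i /fsetUP[/sB|/s'B].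
- move=> i _; apply: EI; case: ifPn => // iP; [exact: Ef|exact: Ef'].
- apply/seteqP; split => [w [ws ws'] i _|w h].
    by split; case: ifPn => // ii; [exact: ws|exact: ws'].
  split => i /= ii.
    have := h i; rewrite /= inE ii => /(_ isT)[].
    by [].
  by have := h i; rewrite /= inE ii orbT => /(_ isT)[].
Qed.

Lemma block_measurable B : block B `<=` measurable.
Proof.
apply: smallest_sub; last exact: cylinder_measurable.
exact: sigma_algebra_measurable.
Qed.

Lemma block_sigma_algebra B : sigma_algebra setT (block B).
Proof. exact: smallest_sigma_algebra. Qed.

Lemma sub_block (B B' : set I) : (B `<=` B') -> block B `<=` block B'.
Proof.
move=> BB'; apply: sub_smallest2r; first exact: block_sigma_algebra.
move=> _ [s [f [sB Ef ->]]].
by exists s, f; split=> // i /sB; exact: BB'.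
Qed.

Lemma generator_block (B : set I) i A : B i -> E i A -> block B A.
Proof.
move=> Bi EA; apply: sub_sigma_algebra; exists [fset i]%fset, (fun=> A); split.
- by move=> j /fset1P ->.
- by move=> j /fset1P ->.
- apply/seteqP; split => [w Aw j //|w]; apply; exact: fset11.
Qed.

Let dynkin_indep (A' : set Omega) : measurable A' ->
  dynkin [set A | measurable A /\ P (A `&` A') = P A * P A'].
Proof.
move=> mA'; split => /=.
- by split; [exact: measurableT|rewrite setTI probability_setT mul1e].
- move=> A [mA AA']; split; first exact: measurableC.
  rewrite probability_setC// muleBl ?fin_num_measure//.
  rewrite mul1e -AA' (measureDI P mA' mA) (setIC A') setDE setIC addeK//.
  by rewrite fin_num_measure//; exact: measurableI.
- move=> F tF FP; have mF n : measurable (F n) by have [] := FP n.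
  split; first exact: bigcupT_measurable.
  rewrite setI_bigcupl !measure_semi_bigcup//.
  + rewrite -(fineK (fin_num_measure P A' mA')) muleC -nneseriesZl//.
    apply: eq_eseriesr => n _; have [_ FA'] := FP n.
    transitivity (P (F n) * P A'); first exact: FA'.
    by rewrite muleC fineK// fin_num_measure.
  + exact: bigcupT_measurable.
  + by move=> n; exact: measurableI.
  + exact: trivIset_setIr.
  + by apply: bigcupT_measurable => n; exact: measurableI.
Qed.

(** Dynkin's lemma, first for events of [block B] against a fixed cylinder over
    [B'], then for events of [block B'] against a fixed event of [block B]. *)
Lemma block_indep (B B' : set I) A A' : [disjoint B & B'] ->
  block B A -> block B' A' -> P (A `&` A') = P A * P A'.
Proof.
move=> BB' bA bA'.
have cyl C C' : cylinders B C -> cylinders B' C' ->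
    P (C `&` C') = P C * P C'.
  move=> [s [f [sB Ef ->]]] [s' [f' [s'B Ef' ->]]].
  pose g i := if i \in s then f i else f' i.
  have ss' i : i \in s' -> i \notin s.
    move=> is'; apply/negP => iss; move: BB' => /disj_setPLR/(_ i (sB _ iss)); apply.
    exact: s'B.
  have gs : (\bigcap_(i in [set` s]) f i = \bigcap_(i in [set` s]) g i).
    by apply: eq_bigcapr => i /= iss; rewrite /g iss.
  have gs' : (\bigcap_(i in [set` s']) f' i = \bigcap_(i in [set` s']) g i).
    by apply: eq_bigcapr => i /= /ss' iss; rewrite /g (negbTE iss).
  have Eg i : i \in (s `|` s')%fset -> E i (g i).
    rewrite inE /g; case: ifPn => [iss _|_ /=]; [exact: Ef|exact: Ef'].
  rewrite gs gs' -bigcap_setU -set_fsetU Eindep//.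
  rewrite !Eindep; last 2 first.
  - by move=> i ii; apply: Eg; rewrite inE ii orbT.
  - by move=> i ii; apply: Eg; rewrite inE ii.
  rewrite (big_fsetID _ (mem s)) /=; congr (_ * _); apply: eq_fbigl => i.
    by rewrite !inE /=; case: (i \in s); rewrite ?andbT ?andbF.
  rewrite !inE /=; case: (boolP (i \in s)) => [iss|_] /=; last by rewrite andbT.
  by apply/esym/negP => /ss'; rewrite iss.
have step1 : forall C', cylinders B' C' -> block B `<=`
    [set C | measurable C /\ P (C `&` C') = P C * P C'].
  move=> C' C'P; apply: lambda_system_subset => //.
  - exact: cylinders_setI.
  - by apply/dynkin_lambda_system/dynkin_indep; exact: cylinder_measurable C'P.
  - by move=> C CP; split; [exact: cylinder_measurable CP|exact: cyl].
have step2 : block B' `<=`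
    [set C' | measurable C' /\ P (C' `&` A) = P C' * P A].
  apply: lambda_system_subset => //.
  - exact: cylinders_setI.
  - by apply/dynkin_lambda_system/dynkin_indep; exact: block_measurable bA.
  - move=> C' C'P; split; first exact: cylinder_measurable C'P.
    by have [_] := step1 C' C'P A bA; rewrite setIC muleC.
by have [_] := step2 A' bA'; rewrite setIC muleC.
Qed.

End BlockIndependence.

(** * Discrete measurability *)

Section DiscreteMeasurability.
Variables (Omega : Type) (G : set_system Omega).
Hypothesis GS : sigma_algebra setT G.

Lemma sigma_setC A : G A -> G (~` A).
Proof. by case: GS => _ + _ => /[apply]; rewrite setTD. Qed.

Lemma sigma_set0 : G set0.
Proof. by case: GS. Qed.

Lemma sigma_setT : G setT.
Proof. by rewrite -setC0; exact/sigma_setC/sigma_set0. Qed.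

Lemma sigma_bigcup (T : countType) (D : set T) (F : T -> set Omega) :
  (forall a, D a -> G (F a)) -> G (\bigcup_(a in D) F a).
Proof.
move=> GF; have [_ _ GU] := GS.
rewrite (_ : \bigcup_(a in D) F a =
    \bigcup_n (if choice.unpickle n is Some a then
                         if a \in D then F a else set0 else set0)).
  apply: GU => n; case: choice.unpickle => [a|]; last exact: sigma_set0.
  by case: ifPn => [/set_mem /GF//|_]; exact: sigma_set0.
apply/seteqP; split => [w [a Da Fa]|w [n _]].
  by exists (choice.pickle a) => //; rewrite choice.pickleK mem_set.
by case: choice.unpickle => [a|//]; case: ifPn => // /set_mem Da Fa; exists a.
Qed.

Lemma sigma_setU A B : G A -> G B -> G (A `|` B).
Proof.
move=> GA GB; rewrite (_ : A `|` B = \bigcup_(b in [set: bool]) (if b then A else B)).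
  by apply: sigma_bigcup => -[].
apply/seteqP; split => [w [?|?]|w [[] _ ?]]; [by exists true|by exists false|by left|by right].
Qed.

Lemma sigma_setI A B : G A -> G B -> G (A `&` B).
Proof.
move=> /sigma_setC GA /sigma_setC GB.
by rewrite -[A]setCK -[B]setCK -setCU; apply/sigma_setC/sigma_setU.
Qed.

Lemma sigma_bigcap (T : countType) (D : set T) (F : T -> set Omega) :
  (forall a, D a -> G (F a)) -> G (\bigcap_(a in D) F a).
Proof.
move=> GF; rewrite -[X in G X]setCK setC_bigcap; apply/sigma_setC/sigma_bigcup.
by move=> a /GF; exact: sigma_setC.
Qed.

(** Measurability into a type endowed with the discrete sigma-algebra, with
    respect to any sigma-algebra on the source. *)
Definition dmeas (T : Type) (f : Omega -> T) := forall A : set T, G (f @^-1` A).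

Lemma dmeas_comp (T U : Type) (f : Omega -> T) (g : T -> U) :
  dmeas f -> dmeas (g \o f).
Proof. by move=> Gf A; rewrite comp_preimage; exact: Gf. Qed.

Lemma dmeas_cst (T : Type) (a : T) : dmeas (fun=> a).
Proof.
move=> A; rewrite preimage_cst; case: ifPn => _; [exact: sigma_setT|exact: sigma_set0].
Qed.

Lemma dmeas_bind (T : countType) (U : Type) (f : Omega -> T) (g : T -> Omega -> U) :
  dmeas f -> (forall a, dmeas (g a)) -> dmeas (fun w => g (f w) w).
Proof.
move=> Gf Gg A; rewrite (_ : _ @^-1` A =
    \bigcup_a (f @^-1` [set a] `&` g a @^-1` A)).
  by apply: sigma_bigcup => a _; apply: sigma_setI; [exact: Gf|exact: Gg].
by apply/seteqP; split => [w gA|w [a _ [/= <- //]]]; exists (f w).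
Qed.

Lemma dmeas_fiber (T : countType) (f : Omega -> T) :
  (forall a, G (f @^-1` [set a])) -> dmeas f.
Proof.
move=> Gf A; rewrite (_ : f @^-1` A = \bigcup_(a in A) f @^-1` [set a]).
  by apply: sigma_bigcup => a _.
by apply/seteqP; split => [w fA|w [a Aa /= ->//]]; exists (f w).
Qed.

Lemma dmeas_map2 (T U : countType) (V : Type) (h : T -> U -> V)
    (f : Omega -> T) (g : Omega -> U) :
  dmeas f -> dmeas g -> dmeas (fun w => h (f w) (g w)).
Proof.
move=> Gf Gg; apply: (@dmeas_bind _ _ f (fun a w => h a (g w))) => // a.
exact: (dmeas_comp (h a) Gg).
Qed.

Lemma dmeas_map (I : eqType) (T : countType) (f : I -> Omega -> T) (s : seq I) :
  (forall i, i \in s -> dmeas (f i)) -> dmeas (fun w => [seq f i w | i <- s]).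
Proof.
elim: s => [|i s IH] Gf; first exact: dmeas_cst.
apply: (@dmeas_map2 _ _ _ cons (f i)); first by apply: Gf; rewrite inE eqxx.
by apply: IH => k ks; apply: Gf; rewrite inE ks orbT.
Qed.

Lemma dmeas_eq (T : Type) (f g : Omega -> T) : f =1 g -> dmeas f -> dmeas g.
Proof. by move=> /funext ->. Qed.

End DiscreteMeasurability.

(** * Sums over countable sets *)

Section CountableSums.
Variables (R : realType).
Local Open Scope ereal_scope.

(** With [pickle_inv] instead of [unpickle], no element is enumerated twice. *)
Definition pickled (T : countType) (S : set T) (a : T -> \bar R) (n : nat) :=
  if choice.pickle_inv n is Some v then if v \in S then a v else 0 else 0.

Lemma pickled_ge0 (T : countType) (S : set T) (a : T -> \bar R) n :
  (forall v, S v -> 0 <= a v) -> 0 <= pickled S a n.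
Proof.
by move=> a0; rewrite /pickled; case: choice.pickle_inv => // v; case: ifPn => // /set_mem/a0.
Qed.

(** Sums over the words of an infinite tree inherit in this way the monotone
    convergence theorem for series. *)
Lemma esum_series (T : countType) (S : set T) (a : T -> \bar R) :
  (forall v, S v -> 0 <= a v) ->
  \esum_(v in S) a v = \sum_(n <oo) pickled S a n.
Proof.
move=> a0; rewrite nneseries_esumT//; last by move=> n; exact: pickled_ge0.
transitivity (\esum_(n in [set choice.pickle v | v in S]) pickled S a n).
  rewrite esum_image; last first.
    by move=> v w _ _ /(pcan_inj choice.pickleK).
  by apply: eq_esum => v Sv; rewrite /pickled choice.pickleK_inv mem_set.
rewrite esum_mkcond; apply: eq_esum => n _; case: ifPn => // /negP nS.
rewrite /pickled; have := choice.pickle_invK (T := T) n.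
case: choice.pickle_inv => [v /= vn|//]; case: ifPn => // /set_mem Sv.
by exfalso; apply: nS; apply/mem_set; exists v.
Qed.

Lemma esumZl (T : countType) (S : set T) (a : T -> \bar R) (x : R) :
  (0 <= x)%R -> (forall v, S v -> 0 <= a v) ->
  \esum_(v in S) (x%:E * a v) = x%:E * \esum_(v in S) a v.
Proof.
move=> x0 a0; rewrite !esum_series//; last first.
  by move=> v Sv; rewrite mule_ge0// a0.
rewrite -nneseriesZl; last by move=> n _; exact: pickled_ge0.
apply: eq_eseriesr => n _; rewrite /pickled.
by case: choice.pickle_inv => [v|]; [case: ifPn|]; rewrite ?mule0.
Qed.

Section Integral.
Context {d : measure_display} {Omega : measurableType d}.
Variable mu : {measure set Omega -> \bar R}.
Variables (T : countType) (S : set T) (f : T -> Omega -> \bar R).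
Hypothesis f0 : forall v w, 0 <= f v w.
Hypothesis mf : forall v, measurable_fun setT (f v).

Let measurable_pickled n : measurable_fun setT (fun w => pickled S (f ^~ w) n).
Proof.
rewrite /pickled; case: choice.pickle_inv => [v|]; last exact: measurable_cst.
by case: (v \in S); [exact: mf|exact: measurable_cst].
Qed.

Lemma measurable_esum : measurable_fun setT (fun w => \esum_(v in S) f v w).
Proof.
rewrite [X in measurable_fun _ X](_ : _ = fun w => \sum_(n <oo) pickled S (f ^~ w) n).
  apply: (@ge0_emeasurable_sum _ _ R setT (fun n w => pickled S (f ^~ w) n) xpredT) => //.
  by move=> k x _ _; exact: pickled_ge0.
by apply/funext => w; rewrite esum_series.
Qed.

Lemma integral_esum :
  \int[mu]_w (\esum_(v in S) f v w) = \esum_(v in S) \int[mu]_w f v w.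
Proof.
rewrite esum_series; last by move=> v _; exact: integral_ge0.
under eq_integral do rewrite esum_series//.
rewrite integral_nneseries//; last by move=> n w _; exact: pickled_ge0.
apply: eq_eseriesr => n _; rewrite /pickled.
by case: choice.pickle_inv => [v|]; [case: ifPn|]; rewrite ?integral0.
Qed.

End Integral.

Lemma integral_nat (mu : {measure set nat -> \bar R}) (f : nat -> \bar R) :
  (forall n, 0 <= f n) -> \int[mu]_n f n = \sum_(n <oo) f n * mu [set n].
Proof.
move=> f0.
have fE n : f n = \sum_(k <oo) f k * (\1_[set k] n)%:E.
  rewrite nneseries_esumT; last by move=> k; rewrite mule_ge0// lee_fin.
  rewrite (esumID [set n]); last by move=> k _; rewrite mule_ge0// lee_fin.
  rewrite setTI esum_set1 ?mule_ge0 ?lee_fin// indicE mem_set// mule1.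
  rewrite esum1 ?adde0// => k [_ /= kn].
  by rewrite indicE memNset ?mule0//= => nk; apply: kn.
under eq_integral do rewrite fE.
rewrite integral_nneseries//; last first.
  by move=> k n _; rewrite mule_ge0// lee_fin.
apply: eq_eseriesr => k _; rewrite ge0_integralZl//.
by rewrite integral_indic// setIT.
Qed.

End CountableSums.

(** * Mean size of a generation *)

Section RandomTrees.
Context {d : measure_display} {Omega : measurableType d} {R : realType}.
Variables (P : probability Omega R).
Variables (nu : probability nat R) (F : probability int R).
Variables (K : nat -> seq nat -> {RV P >-> nat}).
Variables (xi : nat -> seq nat -> nat -> {RV P >-> int}).
Hypothesis hT : iid_labeled_trees nu F K xi.
Local Open Scope ereal_scope.

Local Notation index := (nat * seq nat + nat * seq nat * nat)%type.
Local Notation gen := (generated_by_trees K xi).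
Local Notation blk := (block gen).

Let genT e : gen e setT.
Proof. by case: e => [[i u]|[[i u] k]]; exists setT => //; rewrite preimage_setT setTI. Qed.

Let genI e : setI_closed (gen e).
Proof.
by case: e => [[i u]|[[i u] k]] _ _ [B mB <-] [B' mB' <-];
  exists (B `&` B') => //; rewrite !setTI preimage_setI.
Qed.

Let genM e : gen e `<=` measurable.
Proof.
by case: e => [[i u]|[[i u] k]] _ [B mB <-]; rewrite setTI; exact: measurable_funPTI.
Qed.

Lemma trees_block_indep (B B' : set index) A A' : [disjoint B & B'] ->
  blk B A -> blk B' A' -> P (A `&` A') = P A * P A'.
Proof. by apply: block_indep => //; have [] := hT. Qed.

Lemma trees_block_measurable B A : blk B A -> measurable A.
Proof. exact: block_measurable. Qed.

Lemma blk_sigma B : sigma_algebra setT (blk B).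
Proof. exact: block_sigma_algebra. Qed.

Lemma dmeas_offspring (B : set index) i u : B (inl (i, u)) ->
  dmeas (blk B) (K i u).
Proof.
by move=> Bu A; apply: (generator_block Bu); exists A => //; rewrite setTI.
Qed.

Lemma dmeas_displacement (B : set index) i u k : B (inr (i, u, k)) ->
  dmeas (blk B) (xi i u k).
Proof.
by move=> Bu A; apply: (generator_block Bu); exists A => //; rewrite setTI.
Qed.

Definition in_tree i v : set Omega := [set w | genealogical_tree (fun u => K i u w) v].

Lemma in_tree_nil i : in_tree i [::] = setT.
Proof. by apply/seteqP; split=> // w _ k. Qed.

Lemma in_tree_rcons i v j :
  in_tree i (rcons v j) = in_tree i v `&` K i v @^-1` [set n | (j < n)%N].
Proof.
apply/seteqP; split => [w /= h|w [/= h hj] k].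
  split=> [k kv|].
    have := h k; rewrite size_rcons ltnS => /(_ (ltnW kv)).
    by rewrite nth_rcons kv -cats1 takel_cat// ltnW.
  have := h (size v); rewrite size_rcons => /(_ (ltnSn _)).
  by rewrite nth_rcons ltnn eqxx -cats1 take_size_cat.
rewrite size_rcons ltnS leq_eqVlt => /orP[/eqP ->|kv].
  by rewrite nth_rcons ltnn eqxx -cats1 take_size_cat.
by rewrite nth_rcons kv -cats1 takel_cat ?(ltnW kv)//; exact: h.
Qed.

(** Whether a word belongs to the tree depends on the offspring numbers of its
    proper prefixes only, which are independent of its own and of the labels. *)
Lemma in_tree_block i v :
  blk [set e | exists u, (size u < size v)%N /\ e = inl (i, u)] (in_tree i v).
Proof.
elim/last_ind: v => [|v j IH].
  by rewrite in_tree_nil; exact: sigma_setT (blk_sigma _).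
rewrite in_tree_rcons; apply: (sigma_setI (blk_sigma _)).
  apply: (sub_block _ IH) => _ [u [uv ->]]; exists u; split=> //.
  by rewrite size_rcons ltnS ltnW.
by apply: dmeas_offspring; exists v; rewrite size_rcons.
Qed.

Lemma in_tree_measurable i v : measurable (in_tree i v).
Proof. exact: trees_block_measurable (@in_tree_block i v). Qed.

Lemma prob_in_tree_rcons i v j :
  P (in_tree i (rcons v j)) = P (in_tree i v) * nu [set n | (j < n)%N].
Proof.
have [hK _ _] := hT.
rewrite in_tree_rcons (@trees_block_indep
  [set e | exists u, (size u < size v)%N /\ e = inl (i, u)] [set inl (i, v)]).
- by congr (_ * _); exact: hK.
- by apply/disj_setPLR => e [u [uv ->]] /= [uv']; rewrite uv' ltnn in uv.
- exact: in_tree_block.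
- exact: dmeas_offspring.
Qed.

Hypothesis mean1 : 'E_nu[fun k => k%:R] = 1.

(** The mean of [n] written as the sum over [j] of the indicators of [j < n]. *)
Lemma mean_tail_sum : \esum_(j in [set: nat]) nu [set n | (j < n)%N] = 1.
Proof.
rewrite -mean1 unlock.
transitivity (\int[nu]_n (\esum_(j in [set: nat]) (\1_[set k | (j < k)%N] n)%:E)).
  rewrite integral_esum//.
  by apply: eq_esum => j _; rewrite integral_indic// setIT.
apply: eq_integral => n _.
rewrite (esumID [set j | (j < n)%N]); last by move=> j _; rewrite lee_fin.
rewrite setTI [X in _ + X]esum1 ?adde0; last first.
  by move=> j [_ /= jn]; rewrite indicE memNset.
rewrite esum_fset//.
rewrite -(fsbig_ord _ n (fun j => (\1_[set k | (j < k)%N] n)%:E)).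
rewrite (eq_bigr (fun=> 1)); last by move=> j _; rewrite indicE mem_set//=.
by rewrite sumEFin sumr_const card_ord.
Qed.

Definition words n : set (seq nat) := [set v | size v = n].

Lemma words_succ n : words n.+1 = (fun p => rcons p.1 p.2) @` (words n `*`` fun=> setT).
Proof.
apply/seteqP; split => [v|_ [[v j] [/= vn _] <-]]; last by rewrite /words/= size_rcons vn.
rewrite /words /=; case/lastP: v => [//|v j]; rewrite size_rcons => -[vn].
by exists (v, j).
Qed.

(** A vertex has a child number [j] with the [j]-th tail probability of [nu], and
    these sum up to 1: the mean size of a generation is that of the previous one. *)
Lemma mean_generation i n : \esum_(v in words n) P (in_tree i v) = 1.
Proof.
elim: n => [|n IH].
  rewrite (_ : words 0 = [set [::]]).
    by rewrite esum_set1// in_tree_nil probability_setT.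
  by apply/seteqP; split => [[]|_ ->].
rewrite words_succ esum_image; last first.
  by move=> [v j] [v' j'] _ _ /= /rcons_inj[-> ->].
rewrite -(@esum_esum _ _ _ (words n) (fun=> setT) (fun v j => P (in_tree i (rcons v j))))//.
rewrite -[RHS]IH; apply: eq_esum => v _.
have Pv : P (in_tree i v) \is a fin_num by apply: fin_num_measure; exact: in_tree_measurable.
under eq_esum do rewrite prob_in_tree_rcons -(fineK Pv).
by rewrite esumZl// ?fine_ge0// mean_tail_sum mule1 fineK.
Qed.

End RandomTrees.

(** * Second moments of the labels *)

Section IndependentMoments.
Context {d : measure_display} {Omega : measurableType d} {R : realType}.
Variable P : probability Omega R.
Local Open Scope ereal_scope.

Lemma measurable_int_val d' (T : measurableType d') (X : T -> int) :
  measurable_fun setT X -> measurable_fun setT (fun w => (X w)%:~R : R).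
Proof. by move=> mX; apply: measurableT_comp mX => _ B mB; rewrite setTI. Qed.

(** Fubini's theorem, the joint law being the product of the two laws. *)
Lemma indep_cross_moment (X Y : {mfun Omega >-> int}) :
  (forall A B, P (X @^-1` A `&` Y @^-1` B) = P (X @^-1` A) * P (Y @^-1` B)) ->
  P.-integrable setT (fun w => ((X w)%:~R * (Y w)%:~R : R)%:E) ->
  P.-integrable setT (fun w => ((Y w)%:~R : R)%:E) ->
  \int[P]_w ((Y w)%:~R : R)%:E = 0 ->
  \int[P]_w ((X w)%:~R * (Y w)%:~R : R)%:E = 0.
Proof.
move=> XY iXY iY Y0.
pose f (p : int * int) : \bar R := ((p.1)%:~R * (p.2)%:~R)%:E.
have mf : measurable_fun setT f.
  apply/measurable_EFinP; apply: measurable_funM; apply: measurable_int_val.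
    exact: measurable_fst.
  exact: measurable_snd.
have mXY : measurable_fun setT (fun w => (X w, Y w)) by exact: measurable_fun_pair.
pose XYm : {mfun Omega >-> (int * int)%type} :=
  HB.pack (fun w => (X w, Y w)) (isMeasurableFun.Build _ _ _ _ _ mXY).
have prodE S : measurable S ->
    (distribution P X \x distribution P Y) S = distribution P XYm S.
  move=> mS; apply: product_measure_unique => // A B mA mB.
  exact: XY.
have intE : \int[P]_w ((X w)%:~R * (Y w)%:~R : R)%:E =
    \int[distribution P X \x distribution P Y]_p f p.
  transitivity (\int[distribution P XYm]_p f p).
    by rewrite integral_distribution//.
  by apply: eq_measure_integral => S mS _; exact/esym/prodE.
have iprod : (distribution P X \x distribution P Y).-integrable setT f.
  apply/integrableP; split=> //.
  rewrite (@eq_measure_integral _ _ _ _ (distribution P XYm)); last first.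
    by move=> S mS _; exact: prodE.
  rewrite ge0_integral_distribution//; last exact: measurableT_comp.
  by have /integrableP[] := iXY.
rewrite intE -integral12_prod_meas1//; apply: integral0_eq => x _ /=.
rewrite /fubini_F /f /=.
under eq_integral do rewrite EFinM.
rewrite integralZl//; last first.
  by apply: integrable_pushforward => //; exact: measurable_int_val.
rewrite integral_distribution//.
by transitivity ((x%:~R)%:E * 0 : \bar R); [congr (_ * _); exact: Y0|exact: mule0].
Qed.
End IndependentMoments.

Section Labels.
Context {d : measure_display} {Omega : measurableType d} {R : realType}.
Variables (P : probability Omega R).
Variables (nu : probability nat R) (F : probability int R).
Variables (K : nat -> seq nat -> {RV P >-> nat}).
Variables (xi : nat -> seq nat -> nat -> {RV P >-> int}).
Hypothesis hT : iid_labeled_trees nu F K xi.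
Hypothesis hF : centered_span1 F.
Local Open Scope ereal_scope.
Local Notation blk := (block (generated_by_trees K xi)).

Definition step_variance : R := fine 'V_F[fun x => x%:~R].

Let mintr : measurable_fun setT (fun x : int => x%:~R : R).
Proof. exact: measurable_int_val (@measurable_id _ _ _). Qed.

Lemma step_second_moment : \int[F]_x ((x%:~R : R) ^+ 2)%:E = step_variance%:E.
Proof.
have [_ E0 /andP[V0 Voo]] := hF.
rewrite /step_variance fineK; last by rewrite ge0_fin_numE// ltW.
rewrite /variance unlock E0 /= unlock; apply: eq_integral => x _ /=.
by rewrite !fctE /= subr0 expr2.
Qed.

Lemma step_variance_ge0 : (0 <= step_variance)%R.
Proof. by have [_ _ /andP[V0 _]] := hF; rewrite fine_ge0// ltW. Qed.

Lemma le_norm_sqr_int (x : int) : (`|x%:~R| <= (x%:~R : R) ^+ 2)%R.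
Proof.
rewrite -intr_norm -rmorphXn/= ler_int expr2; nia.
Qed.

Lemma step_integrable : F.-integrable setT (fun x => (x%:~R : R)%:E).
Proof.
apply/integrableP; split; first exact/measurable_EFinP.
apply: (@le_lt_trans _ _ (\int[F]_x ((x%:~R : R) ^+ 2)%:E)); last first.
  by rewrite step_second_moment ltry.
apply: ge0_le_integral => //.
by move=> x _; rewrite /= lee_fin le_norm_sqr_int.
Qed.

Lemma displacement_integral i u k (f : int -> R) : (forall x, 0 <= f x)%R ->
  \int[P]_w (f (xi i u k w))%:E = \int[F]_x (f x)%:E.
Proof.
move=> f0; have [_ hxi _] := hT.
rewrite -(@ge0_integral_distribution _ _ _ _ _ P (xi i u k) (EFin \o f))//.
  by apply: eq_measure_integral => A mA _; exact: hxi.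
Qed.

Lemma displacement_mean i u k :
  P.-integrable setT (fun w => ((xi i u k w)%:~R : R)%:E) /\
  \int[P]_w ((xi i u k w)%:~R : R)%:E = 0.
Proof.
have [_ hxi _] := hT.
have [_ E0 _] := hF.
have iX : P.-integrable setT (fun w => ((xi i u k w)%:~R : R)%:E).
  apply/integrableP; split.
    by apply/measurable_EFinP; exact: measurable_int_val.
  rewrite [ltLHS](displacement_integral i u k (f := fun x => `|x%:~R|%R))//.
  by have /integrableP[] := step_integrable.
split => //.
rewrite -(@integral_distribution _ _ _ _ _ P (xi i u k) (fun x => (x%:~R : R)%:E))//.
rewrite -[RHS]E0 unlock; apply: eq_measure_integral => A mA _; exact: hxi.
Qed.

Lemma label_rcons (x : seq nat -> nat -> int) v j :
  label x (rcons v j) = (label x v + x v j)%R.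
Proof.
rewrite /label size_rcons big_ord_recr /=; congr (_ + _)%R.
  apply: eq_bigr => k _; rewrite nth_rcons ltn_ord -cats1 takel_cat//.
  exact: ltnW.
by rewrite nth_rcons ltnn eqxx -cats1 take_size_cat.
Qed.

(** Every word has a label, in the tree or not, so that the labels do not depend
    on the tree. *)
Definition tree_label i v w := label (fun u k => xi i u k w) v.

Lemma tree_label_rcons i v j w :
  tree_label i (rcons v j) w = (tree_label i v w + xi i v j w)%R.
Proof. exact: label_rcons. Qed.

Lemma tree_label_block i v :
  dmeas (blk [set e | exists u k, (size u < size v)%N /\ e = inr (i, u, k)])
    (tree_label i v).
Proof.
elim/last_ind: v => [|v j IH].
  apply: (dmeas_eq _ (dmeas_cst (blk_sigma _ _ _) 0%R)) => w.
  by rewrite /tree_label /label big_ord0.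
apply: (dmeas_eq (f := fun w => (tree_label i v w + xi i v j w)%R)).
  by move=> w; rewrite tree_label_rcons.
apply: (@dmeas_map2 _ _ (blk_sigma _ _ _) _ _ _ +%R).
  move=> A; apply: (sub_block _ (IH A)) => _ [u [k [uv ->]]].
  by exists u, k; rewrite size_rcons ltnS ltnW.
by apply: dmeas_displacement; exists v, j; rewrite size_rcons.
Qed.

Lemma tree_label_measurable i v : measurable_fun setT (tree_label i v).
Proof.
move=> _ A mA; rewrite setTI; apply: (trees_block_measurable (K := K) (xi := xi)).
exact: tree_label_block.
Qed.

(** The displacement along the last edge is centered and independent of the label
    of the parent, so that the cross term vanishes. *)
Lemma tree_label_second_moment i v :
  \int[P]_w (((tree_label i v w)%:~R : R) ^+ 2)%:E = ((size v)%:R * step_variance)%:E.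
Proof.
elim/last_ind: v => [|v j IH].
  under eq_integral do rewrite /tree_label /label big_ord0 expr0n.
  by rewrite integral0 mul0r.
pose X : {mfun Omega >-> int} :=
  HB.pack (tree_label i v) (isMeasurableFun.Build _ _ _ _ _ (tree_label_measurable i v)).
pose Y := xi i v j.
have Y2 : \int[P]_w (((Y w)%:~R : R) ^+ 2)%:E = step_variance%:E.
  rewrite (displacement_integral i v j (f := fun x => (x%:~R ^+ 2)%R)).
    exact: step_second_moment.
  by move=> x; exact: sqr_ge0.
have mX : measurable_fun setT (fun w => (X w)%:~R : R).
  exact: measurable_int_val (measurable_funPT X).
have mY : measurable_fun setT (fun w => (Y w)%:~R : R).
  exact: measurable_int_val (measurable_funPT Y).
have iX2 : P.-integrable setT (fun w => (((X w)%:~R : R) ^+ 2)%:E).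
  apply/integrableP; split; first by apply/measurable_EFinP; exact: measurable_funX.
  under eq_integral do rewrite /= ger0_norm ?sqr_ge0//.
  by rewrite IH ltry.
have iY2 : P.-integrable setT (fun w => (((Y w)%:~R : R) ^+ 2)%:E).
  apply/integrableP; split; first by apply/measurable_EFinP; exact: measurable_funX.
  under eq_integral do rewrite /= ger0_norm ?sqr_ge0//.
  by rewrite Y2 ltry.
have iS : P.-integrable setT (fun w => (((X w)%:~R : R) ^+ 2)%:E + (((Y w)%:~R : R) ^+ 2)%:E).
  exact: integrableD.
have iXY : P.-integrable setT (fun w => ((X w)%:~R * (Y w)%:~R : R)%:E).
  apply: le_integrable iS => //.
    by apply/measurable_EFinP; exact: measurable_funM.
  move=> w _ /=; rewrite lee_fin normrM [leRHS]ger0_norm ?addr_ge0 ?sqr_ge0//.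
  move: ((X w)%:~R : R) ((Y w)%:~R : R) => x y.
  rewrite -(real_normK (num_real x)) -(real_normK (num_real y)).
  have := sqr_ge0 (`|x| - `|y|)%R; have := mulr_ge0 (normr_ge0 x) (normr_ge0 y).
  by rewrite sqrrB -mulr_natr; lra.
have [iY Y0] := displacement_mean i v j.
have XY0 : \int[P]_w ((X w)%:~R * (Y w)%:~R : R)%:E = 0.
  apply: indep_cross_moment => // A B.
  apply: (trees_block_indep hT (B := [set e | exists u k, (size u < size v)%N /\ e = inr (i, u, k)])
    (B' := [set inr (i, v, j)])).
  - by apply/disj_setPLR => e [u [k [uv ->]]] /= [uv']; rewrite uv' ltnn in uv.
  - exact: tree_label_block.
  - exact: dmeas_displacement.
transitivity (\int[P]_w ((((X w)%:~R : R) ^+ 2)%:E + (((Y w)%:~R : R) ^+ 2)%:E +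
    2%:E * ((X w)%:~R * (Y w)%:~R : R)%:E)).
  apply: eq_integral => w _; rewrite tree_label_rcons -EFinM -!EFinD; congr EFin.
  by rewrite rmorphD/= /X /Y /=; ring.
rewrite integralD//; last exact: integrableZl.
rewrite integralD// integralZl// XY0 mule0 adde0 IH Y2 size_rcons -EFinD.
by congr EFin; rewrite -[in RHS]addn1 natrD; ring.
Qed.

(** Markov's inequality for the squared label, which is independent of the event
    that the vertex belongs to the tree. *)
Lemma far_vertex_le i v (a : R) : (0 < a)%R ->
  P (in_tree K i v `&` [set w | (a <= `|(tree_label i v w)%:~R|)%R]) <=
  P (in_tree K i v) * ((size v)%:R * step_variance / a ^+ 2)%:E.
Proof.
move=> a0.
pose A : set int := [set x | (a <= `|x%:~R|)%R].
rewrite (trees_block_indep hT (B := [set e | exists u, (size u < size v)%N /\ e = inl (i, u)])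
  (B' := [set e | exists u k, (size u < size v)%N /\ e = inr (i, u, k)])); last 3 first.
- by apply/disj_setPLR => _ [u [_ ->]] /= [u' [k [_ //]]].
- exact: in_tree_block.
- by have := @tree_label_block i v A.
apply: lee_wpmul2l => //.
have mA : measurable (tree_label i v @^-1` A).
  by rewrite -[X in measurable X]setTI; exact: tree_label_measurable.
rewrite [X in X <= _](_ : _ = \int[P]_w (\1_(tree_label i v @^-1` A) w)%:E); last first.
  by rewrite integral_indic// setIT.
have a2 : (0 < a ^+ 2)%R by rewrite exprn_gt0.
rewrite mulrC EFinM -(tree_label_second_moment i v) -ge0_integralZl_EFin//; last 2 first.
- by apply/measurable_EFinP/measurable_funX; exact: measurable_int_val (tree_label_measurable i v).
- by rewrite invr_ge0 ltW.
apply: ge0_le_integral => //.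
- by apply/measurable_EFinP; exact: measurable_indic.
- apply: measurable_funeM; apply/measurable_EFinP/measurable_funX.
  exact: measurable_int_val (tree_label_measurable i v).
- move=> w _; rewrite -EFinM lee_fin indicE.
  have [/set_mem /= wA|_] := boolP (w \in _); last by rewrite mulr_ge0// ?invr_ge0 ?sqr_ge0 ?ltW.
  rewrite mulrC ler_pdivlMr// mul1r -[leRHS]real_normK ?num_real//.
  by rewrite ler_sqr ?nnegrE// ltW.
- by move=> w _; rewrite lee_fin sqr_ge0.
Qed.

End Labels.

(** * Survival probabilities *)

Section Survival.
Context {d : measure_display} {Omega : measurableType d} {R : realType}.
Variables (P : probability Omega R).
Variables (nu : probability nat R) (F : probability int R).
Variables (K : nat -> seq nat -> {RV P >-> nat}).
Variables (xi : nat -> seq nat -> nat -> {RV P >-> int}).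
Hypothesis hT : iid_labeled_trees nu F K xi.
Hypothesis hnu : critical_offspring nu.
Local Open Scope ereal_scope.
Local Notation blk := (block (generated_by_trees K xi)).

Definition branching : R := fine (nu [set k | (2 <= k)%N]).

Let branchingE : branching%:E = nu [set k | (2 <= k)%N].
Proof. by rewrite fineK// fin_num_measure. Qed.

(** Without vertices having at least two children, the offspring law with mean 1
    would be deterministic. *)
Lemma branching_gt0 : (0 < branching)%R.
Proof.
rewrite lt_neqAle fine_ge0// andbT; apply/eqP => b0.
have [E1 /andP[V0 _]] := hnu.
move: V0; rewrite /variance unlock E1 /= unlock.
suff -> : \int[nu]_k ((((fun k => k%:R) \- cst 1) * ((fun k => k%:R) \- cst 1)) k : R)%:E = 0.
  by rewrite ltxx.
set f := fun k : nat => ((((fun k => k%:R) \- cst 1) * ((fun k => k%:R) \- cst 1)) k : R)%:E.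
have f0 k : 0 <= f k by rewrite lee_fin /f /= -expr2 sqr_ge0.
have : \int[nu]_k (f k + (k%:R : R)%:E) = \int[nu]_k 1.
  apply: ge0_ae_eq_integral => //.
  - by move=> k _; rewrite adde_ge0// lee_fin.
  - exists [set k | (2 <= k)%N]; split => //.
      exact: etrans (esym branchingE) (congr1 EFin (esym b0)).
    move=> k /= /not_implyP[_ kE]; rewrite leqNgt; apply/negP => k2; apply: kE.
    move: k k2 => [|[|//]] _; rewrite /f -EFinD /cst !fctE/=; congr EFin; ring.
rewrite ge0_integralD//.
move: E1; rewrite unlock => ->.
rewrite integral_cst// [X in _ * X]probability_setT mul1e => h.
by have := congr1 (fun x => x - 1) h; rewrite addeK// subee.
Qed.

(** The subtree above [u] reaches depth [n], irrespective of whether [u] is in the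
    tree; the subtrees above distinct siblings then depend on disjoint blocks. *)
Definition survives i n u : set Omega := [set w | exists v, size v = n /\
  forall k, (k < n)%N -> (nth 0 v k < K i (u ++ take k v) w)%N].

Lemma survives0 i u : survives i 0 u = setT.
Proof. by apply/seteqP; split=> // w _; exists [::]. Qed.

Lemma survives_succ i n u : survives i n.+1 u =
  \bigcup_j (K i u @^-1` [set k | (j < k)%N] `&` survives i n (rcons u j)).
Proof.
apply/seteqP; split => [w [[|j v] [//= [vn] h]]|w [j _ [/= jK [v [vn h]]]]].
  exists j => //; split; first by have := h 0%N isT; rewrite take0 cats0.
  exists v; split=> // k kn; have := h k.+1 kn.
  by rewrite /= cat_rcons.
exists (j :: v); split=> /=; first by rewrite vn.
move=> [_|k kn]; first by rewrite take0 cats0.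
by have := h k kn; rewrite cat_rcons.
Qed.

Lemma survives_block i n u :
  blk [set e | exists x, e = inl (i, u ++ x)] (survives i n u).
Proof.
elim: n u => [|n IH] u.
  by rewrite survives0; exact: sigma_setT (blk_sigma _ _ _).
rewrite survives_succ; apply: (sigma_bigcup (blk_sigma _ _ _)) => j _.
apply: (sigma_setI (blk_sigma _ _ _)).
  by apply: dmeas_offspring; exists [::]; rewrite cats0.
apply: (sub_block _ (IH (rcons u j))) => _ [x ->]; exists (j :: x).
by rewrite cat_rcons.
Qed.

Let survives_measurable i n u : measurable (survives i n u).
Proof. exact: trees_block_measurable (@survives_block i n u). Qed.

(** The first [k] potential children of [u] count here whether or not they are
    born, so that this event is independent of the offspring number of [u]. *)
Let barren i n u k : set Omega := [set w | forall j, (j < k)%N -> ~ survives i n (rcons u j) w].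

Let barren_succ i n u k :
  barren i n u k.+1 = barren i n u k `&` ~` survives i n (rcons u k).
Proof.
apply/seteqP; split => [w h|w [h hk] j].
  by split=> [j jk|]; apply: h => //; exact: ltnW.
by rewrite ltnS leq_eqVlt => /orP[/eqP ->//|]; exact: h.
Qed.

Let barren_block i n u k :
  blk [set e | exists j x, (j < k)%N /\ e = inl (i, rcons u j ++ x)] (barren i n u k).
Proof.
elim: k => [|k IH].
  rewrite (_ : barren i n u 0 = setT); first exact: sigma_setT (blk_sigma _ _ _).
  by apply/seteqP; split.
rewrite barren_succ; apply: (sigma_setI (blk_sigma _ _ _)).
  apply: (sub_block _ IH) => _ [j [x [jk ->]]]; exists j, x; split=> //.
  exact: ltnW.
apply: (sigma_setC (blk_sigma _ _ _)).
by apply: (sub_block _ (@survives_block i n (rcons u k))) => _ [x ->]; exists k, x.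
Qed.

Let barren_ge i n u k (x : R) : (0 <= x <= 1)%R ->
  (forall j, P (survives i n (rcons u j)) <= x%:E) ->
  ((1 - x) ^+ k)%:E <= P (barren i n u k).
Proof.
move=> /andP[x0 x1] sx; elim: k => [|k IH].
  rewrite (_ : barren i n u 0 = setT); first by rewrite probability_setT.
  by apply/seteqP; split.
rewrite barren_succ (trees_block_indep hT
  (B := [set e | exists j x, (j < k)%N /\ e = inl (i, rcons u j ++ x)])
  (B' := [set e | exists x, e = inl (i, rcons u k ++ x)])); last 3 first.
- apply/disj_setPLR => _ [j [y [jk ->]]] /= [y' [/eqP]].
  rewrite !cat_rcons eqseq_cat// eqxx /= eqseq_cons => /andP[/eqP jk' _].
  by rewrite jk' ltnn in jk.
- exact: barren_block.
- by apply: (sigma_setC (blk_sigma _ _ _)); exact: survives_block.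
rewrite exprSr EFinM; apply: lee_pmul => //.
- by rewrite lee_fin exprn_ge0// subr_ge0.
- by rewrite lee_fin subr_ge0.
- rewrite probability_setC// EFinB leeB//.
Qed.

Let pow_sub_le (x : R) k : (0 <= x <= 1)%R ->
  ((1 - x) ^+ k + x * k%:R <= (1 - x) ^+ k.+1 + x * k.+1%:R)%R.
Proof.
move=> /andP[x0 x1]; rewrite exprS -natr1.
have : (0 <= x * (1 - (1 - x) ^+ k))%R.
  by rewrite mulr_ge0// subr_ge0 exprn_ile1//; lra.
lra.
Qed.

(** Bernoulli's inequality with a second-order term. *)
Let pow_sub_ge (x : R) k : (0 <= x <= 1)%R ->
  (1 + x ^+ 2 * (2 <= k)%N%:R <= (1 - x) ^+ k + x * k%:R)%R.
Proof.
move=> x01; have [x0 x1] := andP x01; elim: k => [|k IH].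
  by rewrite !mulr0 expr0; lra.
case: k IH => [|[|k]] IH; first by rewrite mulr0 expr1; lra.
  by rewrite !mulr1 !expr2; lra.
exact: le_trans IH (pow_sub_le _ x01).
Qed.

(** If [u] has [k] children, the subtree above [u] stays below depth [n.+1] with a
    probability of at least [(1 - x) ^+ k], and [pow_sub_ge] is integrated over
    [k], whose mean is 1. *)
Let survival_step i n u (x : R) : (0 <= x <= 1)%R ->
  (forall j, P (survives i n (rcons u j)) <= x%:E) ->
  P (survives i n.+1 u) <= (x - branching * x ^+ 2)%:E.
Proof.
move=> x01 sx; have [x0 x1] := andP x01; have [hK _ _] := hT.
have [E1 _] := hnu.
have nsurvE : ~` survives i n.+1 u = \bigcup_k (K i u @^-1` [set k] `&` barren i n u k).
  rewrite survives_succ; apply/seteqP; split => [w h|w [k _ [/= <- h]] [j _ [/= jK]]].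
    exists (K i u w) => //; split=> // j jk js; apply: h; exists j => //.
  exact: h.
have mbar k : measurable (barren i n u k).
  exact: trees_block_measurable (@barren_block i n u k).
have : \int[nu]_k ((1 - x) ^+ k)%:E <= P (~` survives i n.+1 u).
  rewrite nsurvE measure_semi_bigcup; last 3 first.
  - by move=> k; apply: measurableI => //; exact: measurable_funPTI.
  - apply/trivIsetP => k k' _ _ kk'; apply/seteqP; split=> // w [[/= Kk _] [/= Kk' _]].
    by rewrite -Kk -Kk' eqxx in kk'.
  - by apply: bigcupT_measurable => k; apply: measurableI => //; exact: measurable_funPTI.
  rewrite integral_nat; last by move=> k; rewrite lee_fin exprn_ge0// subr_ge0.
  apply: lee_nneseries => [k _ _|k _].
    by rewrite mule_ge0// lee_fin exprn_ge0// subr_ge0.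
  rewrite [leRHS](trees_block_indep hT (B := [set inl (i, u)])
    (B' := [set e | exists j x, (j < k)%N /\ e = inl (i, rcons u j ++ x)])); last 3 first.
  - apply/disj_setPLR => _ -> /= [j [y [_ [/(congr1 size)]]]].
    by rewrite cat_rcons size_cat /=; lia.
  - exact: dmeas_offspring.
  - exact: barren_block.
  rewrite muleC [X in _ <= X * _]hK.
  by apply: lee_wpmul2l => //; exact: barren_ge.
have intx : \int[nu]_k ((1 - x) ^+ k)%:E + x%:E >= (1 + branching * x ^+ 2)%:E.
  have -> : x%:E = \int[nu]_k (x%:E * (k%:R)%:E).
    by rewrite ge0_integralZl//; move: E1; rewrite unlock => ->; rewrite mule1.
  rewrite -ge0_integralD//; last 2 first.
  - by move=> k _; rewrite lee_fin exprn_ge0// subr_ge0.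
  - by move=> k _; rewrite mule_ge0.
  have -> : (1 + branching * x ^+ 2)%:E =
      \int[nu]_k (1 + (x ^+ 2)%:E * (\1_[set k | (2 <= k)%N] k)%:E).
    rewrite ge0_integralD//; last by move=> k _; rewrite mule_ge0// lee_fin ?sqr_ge0.
    rewrite integral_cst// [X in _ * X + _]probability_setT mul1e ge0_integralZl//; last first.
      by rewrite lee_fin sqr_ge0.
    by rewrite integral_indic// setIT EFinD mulrC EFinM branchingE.
  apply: ge0_le_integral => //.
  - by move=> k _; rewrite adde_ge0// mule_ge0// lee_fin ?sqr_ge0.
  - move=> k _; rewrite -!EFinM -!EFinD lee_fin indicE.
    rewrite (_ : (k \in _) = (2 <= k)%N); first exact: pow_sub_ge.
    by apply/idP/idP => [/set_mem//|k2]; apply/mem_set.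
have fin_s : P (survives i n.+1 u) \is a fin_num by exact: fin_num_measure.
move=> h; have : \int[nu]_k ((1 - x) ^+ k)%:E + x%:E <= P (~` survives i n.+1 u) + x%:E.
  by rewrite leeD2r.
move=> /(le_trans intx); rewrite probability_setC// -(fineK fin_s) -EFinB -EFinD !lee_fin.
lra.
Qed.

(** Kolmogorov's estimate: by [survival_step] the survival probabilities decrease
    at least as fast as the solution of [x' = - branching * x ^ 2]. *)
Lemma survival_le i n u : P (survives i n u) <= ((1 + branching * n%:R)^-1)%:E.
Proof.
have c0 := branching_gt0.
have c1 : (branching <= 1)%R by rewrite -lee_fin branchingE; exact: probability_le1.
elim: n u => [|n IH] u.
  by rewrite survives0 probability_setT mulr0 addr0 invr1.
have y0 : (0 <= branching * n%:R)%R by rewrite mulr_ge0// ltW.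
have y1 : (0 < 1 + branching * n%:R)%R by rewrite ltr_wpDr.
apply: (le_trans (survival_step (x := (1 + branching * n%:R)^-1) _ _)).
- by rewrite invr_ge0 ltW//= invf_le1// lerDl.
- by move=> j; exact: IH.
rewrite lee_fin -natr1 mulrDr mulr1.
rewrite [(_ + (_ + branching))%R]addrA; move: y1; set y := (1 + _)%R => y1.
have yc : (0 < y + branching)%R by rewrite addr_gt0.
rewrite -[leRHS]mul1r ler_pdivlMr//.
have yy : (y^-1 * y = 1)%R by rewrite mulVf// gt_eqF.
have : (0 <= (branching * y^-1) ^+ 2)%R by exact: sqr_ge0.
move: (y^-1)%R yy => z zy; rewrite !expr2 => h.
have -> : ((z - branching * (z * z)) * (y + branching) =
  z * y + branching * z - branching * z * (z * y) - branching * z * (branching * z))%R by ring.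
by rewrite zy; lra.
Qed.

End Survival.

(** * Paths of the rescaled densities *)

Section PrelimitPaths.
Variable R : realType.
Variables (K : nat -> seq nat -> nat) (xi : nat -> seq nat -> nat -> int).
Variable N : nat.
Hypothesis N0 : (0 < N)%N.

Let N0R : 0 < N%:R :> R. Proof. by rewrite ltr0n. Qed.

Let sqrtN_gt0 : 0 < Num.sqrt (N%:R : R). Proof. by rewrite sqrtr_gt0. Qed.

(** This is the jump caused by the tree number [i], see [jump_tree_time]. *)
Definition tree_profile (i : nat) : c0 R :=
  \sum_(v <- vertices (K i)) (N%:R `^ (- (3 / 2))) *: tent sqrtN_gt0 (label (xi i) v).

Lemma occupation_interpolation i (x : R) :
  linear_interpolation (fun j => (occupation (K i) (xi i) j)%:R) x =
  \sum_(v <- vertices (K i)) unit_tent (x - (label (xi i) v)%:~R).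
Proof.
rewrite /occupation; elim: (enum_fset _) => [|v s IH].
  by rewrite big_nil /linear_interpolation/= !mulr0 addr0.
rewrite big_cons -IH -linear_interpolation_delta /linear_interpolation /=.
by rewrite !natrD; ring.
Qed.

Lemma densityB i : density R K xi N i.+1 - density R K xi N i = tree_profile i.
Proof.
apply: c0_eqP => x; rewrite c0B c0_sum.
under eq_bigr do rewrite c0Z tentE.
rewrite -mulr_sumr -occupation_interpolation /= /rescaled_occupation -mulrBr.
congr (_ * _); rewrite /linear_interpolation /total_occupation.
by rewrite !big_ord_recr/= !natrD; ring.
Qed.

Definition tree_time (i : nat) : R := i.+1%:R / N%:R.

Lemma tree_time_gt0 i : 0 < tree_time i.
Proof. by rewrite divr_gt0. Qed.

Lemma tree_time_inj : injective tree_time.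
Proof.
move=> i j /(congr1 (fun x => x * N%:R)); rewrite !divfK ?gt_eqF//.
by move=> /(mulrIn (oner_neq0 R)) [].
Qed.

Lemma truncn_tree_time i : Num.truncn (i%:R / N%:R * N%:R : R) = i.
Proof. by rewrite divfK ?gt_eqF// natrK. Qed.

Lemma ordered_jumpE j :
  ordered_jump R K xi N j = tree_profile (nth 0%N (trees_by_size K N) j).
Proof. by rewrite /ordered_jump /= !truncn_tree_time densityB. Qed.

Lemma jump_tree_time i : jump (rescaled_density R K xi N) (tree_time i) = tree_profile i.
Proof.
rewrite /jump -densityB /= truncn_tree_time; congr (_ - _).
apply: cvg_lim => //.
apply: (@cvg_trans _ ((fun=> density R K xi N i) @ (tree_time i)^'-)); last exact: cvg_cst.
apply: near_eq_cvg; near=> s; congr (density R K xi N _); apply/esym.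
apply: truncn_def; rewrite -ler_pdivrMr// -ltr_pdivlMr//; apply/andP; split.
  near: s; apply: nbhs_left_ge.
  by rewrite ltr_pM2r ?invr_gt0// ltr_nat.
by near: s; exact: nbhs_left_lt.
Unshelve. all: by end_near. Qed.

Lemma jump_not_tree_time t : 0 <= t -> (forall i, t <> tree_time i) ->
  jump (rescaled_density R K xi N) t = 0.
Proof.
rewrite le_eqVlt => /orP[/eqP <- _|t0 ti]; first exact: jump_le0.
rewrite /jump /=; apply/eqP; rewrite subr_eq0; apply/eqP/esym.
apply: cvg_lim => //.
set i := Num.truncn (t * N%:R).
have tN0 : 0 <= t * N%:R by rewrite mulr_ge0// ltW.
have /andP[it ti'] := truncn_itv tN0.
have {}it : i%:R < t * N%:R.
  rewrite lt_neqAle it andbT; apply/eqP => iE.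
  have i0 : (0 < i)%N by rewrite lt0n; apply: contraTN (mulr_gt0 t0 N0R) => /eqP i0; rewrite -iE i0 ltxx.
  by apply: (ti i.-1); rewrite /tree_time prednK// iE mulfK// gt_eqF.
apply: (@cvg_trans _ ((fun=> density R K xi N i) @ t^'-)); last exact: cvg_cst.
apply: near_eq_cvg; near=> s; congr (density R K xi N _); apply/esym.
apply: truncn_def; apply/andP; split.
  rewrite -ler_pdivrMr//; near: s; apply: nbhs_left_ge.
  by rewrite ltr_pdivrMr.
apply: lt_trans ti'; rewrite ltr_pM2r//; near: s; exact: nbhs_left_lt.
Unshelve. all: by end_near. Qed.

(** The area of [tree_profile i] over the whole line, in terms of the size of the
    tree. *)
Definition tree_area (i : nat) : R := unit_tent_area R / N%:R ^+ 2 * (tree_size (K i))%:R.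

Lemma tree_area_ge0 i : 0 <= tree_area i.
Proof.
have [_ /andP[c0 _]] := unit_tent_areaE R.
by rewrite mulr_ge0// divr_ge0// exprn_ge0// ltW.
Qed.

Let scaleE : N%:R `^ (- (3 / 2)) * (unit_tent_area R / Num.sqrt N%:R) =
  unit_tent_area R / N%:R ^+ 2.
Proof.
rewrite mulrCA; congr (_ * _); rewrite -powR12_sqrt ?ltW// -powRN -powRD; last first.
  by apply/implyP => _; rewrite gt_eqF.
rewrite -powR_mulrn ?ltW// -powRN; congr (_ `^ _); lra.
Qed.

Lemma window_area_profileE q i : window_area q (tree_profile i) =
  \sum_(v <- vertices (K i)) N%:R `^ (- (3 / 2)) * window_area q (tent sqrtN_gt0 (label (xi i) v)).
Proof. by rewrite window_area_sum; apply: eq_bigr => v _; rewrite window_areaZ. Qed.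

Let sum_vertices i (x : R) : \sum_(v <- vertices (K i)) x = x * (tree_size (K i))%:R.
Proof. by rewrite big_const_seq iter_addr_0 count_predT mulr_natr. Qed.

Lemma window_area_profile_le q i : window_area q (tree_profile i) <= tree_area i.
Proof.
rewrite window_area_profileE /tree_area -scaleE -sum_vertices.
by apply: ler_sum => v _; rewrite ler_wpM2l ?powR_ge0// window_tent_le.
Qed.

(** Only the tents that reach out of the window lose some area. *)
Lemma window_area_profile_ge q i : tree_area i - unit_tent_area R / N%:R ^+ 2 *
    (count (fun v => Num.sqrt (N%:R : R) * q%:R < `|(label (xi i) v)%:~R| + 1)
      (vertices (K i) : seq (seq nat)))%:R
  <= window_area q (tree_profile i).
Proof.
rewrite window_area_profileE /tree_area -mulrBr -scaleE.
rewrite -[(tree_size _)%:R]mul1r -sum_vertices.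
rewrite -sum1_count natr_sum [X in _ - X]big_mkcond/= -sumrB mulr_sumr.
apply: ler_sum => v _; rewrite -mulrA ler_wpM2l ?powR_ge0//.
case: ltP => lv; last by rewrite subr0 mulr1 window_tent_eq.
rewrite subrr mulr0 fine_ge0//; apply: integral_ge0 => x _.
by rewrite lee_fin tent_ge0.
Qed.

Lemma trees_by_size_perm : perm_eq (trees_by_size K N) (iota 0 N).
Proof. by rewrite perm_sort. Qed.

Lemma trees_by_size_nth j k : (j <= k)%N -> (k < N)%N ->
  (tree_size (K (nth 0%N (trees_by_size K N) k)) <=
   tree_size (K (nth 0%N (trees_by_size K N) j)))%N.
Proof.
move=> jk kN.
pose leT := fun i i' => (tree_size (K i') < tree_size (K i))%N ||
                    ((tree_size (K i) == tree_size (K i')) && (i <= i')%N).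
have szT : size (trees_by_size K N) = N by rewrite size_sort size_iota.
have leT_total : total leT by move=> x y; rewrite /leT; lia.
have leT_trans : transitive leT by move=> y x z; rewrite /leT; lia.
have leT_refl : reflexive leT by move=> x; rewrite /leT; lia.
have srt : sorted leT (trees_by_size K N) by exact: sort_sorted.
have := sorted_leq_nth leT_trans leT_refl 0%N srt j k.
rewrite !inE szT => /(_ (leq_ltn_trans jk kN) kN jk).
by rewrite /leT; lia.
Qed.

Variables (m q : nat) (n C rho : R) (h : ('I_m -> c0 R) -> R).
Hypotheses (mN : (m <= N)%N) (rho0 : 0 <= rho).
Let a : R := q%:R ^+ 2.
Local Notation y := (rescaled_density R K xi N).
Local Notation rank := (nth 0%N (trees_by_size K N)).
Hypothesis area_score : forall i, (i < N)%N ->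
  tree_area i <= score (window_area q) a y (tree_time i) + rho.
Hypotheses (h0 : forall x, 0 <= h x) (n0 : 0 < n) (C0 : 0 <= C).

(** The true times and jumps are admissible with [r = rho]: a competitor for
    rank [k] scores at most its area, hence at most the area of the tree of rank
    [k], hence at most the score of the latter plus [rho]. Trees that come after
    time 1 score at most 0, as do the times without a tree. *)
Lemma ranked_inf_prelimit :
  ranked_inf (window_area q) a n C h y <=
  h (fun k : 'I_m => ordered_jump R K xi N k) + n * rho.
Proof.
have uniqT : uniq (trees_by_size K N) by rewrite sort_uniq iota_uniq.
have szT : size (trees_by_size K N) = N by rewrite size_sort size_iota.
have rankN k : (k < N)%N -> (rank k < N)%N.
  move=> kN; have : rank k \in iota 0 N.
    by rewrite -(perm_mem trees_by_size_perm) mem_nth// szT.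
  by rewrite mem_iota add0n.
have a0 : 0 <= a by rewrite exprn_ge0.
have kN (k : 'I_m) : (k < N)%N by apply: leq_trans mN.
apply: ge_inf.
  by exists 0 => c; exact: ranked_values_ge0.
right; exists (fun k : 'I_m => tree_time (rank k)),
  (fun k : 'I_m => ordered_jump R K xi N k), rho.
split=> //; split=> //.
- move=> k l /tree_time_inj /eqP; rewrite nth_uniq ?szT//.
  by move=> /eqP; exact: val_inj.
- by move=> k; rewrite ltW// tree_time_gt0.
- move=> k s s0 hs; apply: le_trans (area_score (rankN _ (kN k))).
  have [[i si]|ns] := pselect (exists i, s = tree_time i); last first.
    apply: (@le_trans _ _ 0); last exact: tree_area_ge0.
    rewrite /score ge_min jump_not_tree_time ?window_area0 ?lexx// => i si.
    by apply: ns; exists i.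
  have [iN|Ni] := ltnP i N; last first.
    apply: (@le_trans _ _ 0); last exact: tree_area_ge0.
    rewrite /score ge_min; apply/orP; right.
    by rewrite mulr_ge0_le0// subr_le0 si ler_pdivlMr// mul1r ler_nat ltnW.
  rewrite /score ge_min si jump_tree_time; apply/orP; left.
  apply: (le_trans (window_area_profile_le _ _)).
  have iT : i \in trees_by_size K N by rewrite (perm_mem trees_by_size_perm) mem_iota.
  pose p := index i (trees_by_size K N).
  have pN : (p < N)%N by rewrite -szT index_mem.
  have ip : rank p = i by exact: nth_index.
  have kp : (k <= p)%N.
    rewrite leqNgt; apply/negP => pk.
    case: hs => [s_0|/(_ (Ordinal (ltn_trans pk (ltn_ord k))) pk)].
      by have := tree_time_gt0 i; rewrite -si s_0 ltxx.
    by rewrite /= ip si.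
  rewrite /tree_area ler_wpM2l ?ler_nat -?ip ?trees_by_size_nth//.
  by have [_ /andP[c0 _]] := unit_tent_areaE R; rewrite divr_ge0// exprn_ge0// ltW.
- by move=> k; rewrite jump_tree_time ordered_jumpE subrr normr0.
Qed.

End PrelimitPaths.

(** * Trees lose little area in the score *)

Section TreeMasses.
Context {d : measure_display} {Omega : measurableType d} {R : realType}.
Variables (P : probability Omega R).
Variables (nu : probability nat R) (F : probability int R).
Variables (K : nat -> seq nat -> {RV P >-> nat}).
Variables (xi : nat -> seq nat -> nat -> {RV P >-> int}).
Hypothesis hT : iid_labeled_trees nu F K xi.
Hypothesis hnu : critical_offspring nu.
Hypothesis hF : centered_span1 F.
Local Open Scope ereal_scope.

Lemma markov_bound (f : Omega -> \bar R) (x e : R) : measurable_fun setT f ->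
  (forall w, 0 <= f w) -> (0 < x)%R -> \int[P]_w f w <= e%:E ->
  measurable [set w | x%:E <= f w] /\ P [set w | x%:E <= f w] <= (e / x)%:E.
Proof.
move=> mf f0 x0 fe.
have mB : measurable [set w | x%:E <= f w].
  rewrite -[X in measurable X]setTI; exact: emeasurable_fun_c_infty.
split=> //; rewrite mulrC EFinM -[leLHS]mul1e.
have -> : 1 = x^-1%:E * x%:E :> \bar R by rewrite -EFinM mulVf// gt_eqF.
rewrite -muleA; apply: lee_wpmul2l; first by rewrite lee_fin invr_ge0 ltW.
apply: le_trans fe; set B := [set w | x%:E <= f w].
have -> : x%:E * P B = \int[P]_w (x%:E * (\1_B w)%:E).
  rewrite ge0_integralZl_EFin ?integral_indic ?setIT// ?ltW//.
  by apply/measurable_EFinP; exact: measurable_indic.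
apply: ge0_le_integral => //.
- by move=> w _; rewrite mule_ge0// lee_fin// ltW.
- by apply: measurable_funeM; apply/measurable_EFinP; exact: measurable_indic.
- move=> w _; rewrite indicE; have [/set_mem /= xf|_] := boolP (w \in _).
    by rewrite mule1.
  by rewrite mule0.
Qed.

(** All trees without vertices in generation [H] are contained in this set. *)
Definition young H : set (seq nat) := [set v | (size v < H)%N].

Lemma esum_young H (f : seq nat -> \bar R) : (forall v, 0 <= f v) ->
  \esum_(v in young H) f v = \sum_(n < H) \esum_(v in words n) f v.
Proof.
move=> f0; elim: H => [|H IH].
  by rewrite big_ord0 (_ : young 0 = set0) ?esum_set0//; apply/seteqP; split.
rewrite big_ord_recr/= -IH (esumID (words H) (young H.+1))//.
have -> : young H.+1 `&` words H = words H.
  by apply/seteqP; split => [v []//|v /= vH]; split=> //; rewrite /young/= vH.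
have -> : young H.+1 `&` ~` words H = young H.
  apply/seteqP; split => [v [/= vH nv]|v /= vH].
    by rewrite /young /= ltn_neqAle -ltnS vH andbT; apply/eqP.
  by split; [exact: ltnW|move=> /= vE; rewrite /young/= vE ltnn in vH].
by rewrite addeC.
Qed.

(** Its values are extended reals because [young H] is infinite. *)
Definition census H (A : seq nat -> set Omega) (w : Omega) : \bar R :=
  \esum_(v in young H) (\1_(A v) w)%:E.

Lemma census_ge0 H A w : 0 <= census H A w.
Proof. by apply: esum_ge0 => v _; rewrite lee_fin. Qed.

Lemma measurable_census H A : (forall v, measurable (A v)) ->
  measurable_fun setT (census H A).
Proof.
move=> mA; apply: measurable_esum => [v w|v]; first by rewrite lee_fin.
by apply/measurable_EFinP; exact: measurable_indic.
Qed.

Lemma integral_census H A : (forall v, measurable (A v)) ->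
  \int[P]_w census H A w = \esum_(v in young H) P (A v).
Proof.
move=> mA; rewrite integral_esum => [|v w|v].
- by apply: eq_esum => v _; rewrite integral_indic// setIT.
- by rewrite lee_fin.
- by apply/measurable_EFinP; exact: measurable_indic.
Qed.

Lemma count_le_census H A w (V : {fset seq nat}) (b : pred (seq nat)) :
  (forall v, v \in V -> b v -> (size v < H)%N /\ A v w) ->
  (count b V)%:R%:E <= census H A w.
Proof.
move=> VA; apply: esum_ge; exists [set` [seq v <- V | b v]].
  split; first exact: finite_seq.
  by move=> v /=; rewrite mem_filter => /andP[bv vV]; have [] := VA v vV bv.
rewrite -fsbig_seq; last by rewrite filter_uniq// fset_uniq.
rewrite (eq_big_seq (fun=> 1)); last first.
  move=> v; rewrite mem_filter => /andP[bv vV]; have [_ Av] := VA v vV bv.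
  by rewrite indicE mem_set.
by rewrite sumEFin big_const_seq iter_addr_0 count_predT size_filter.
Qed.

Lemma mean_young_mass i H :
  \esum_(v in young H) P (in_tree K i v) = H%:R%:E.
Proof.
rewrite esum_young//.
under eq_bigr do rewrite (mean_generation hT (proj1 hnu)).
by rewrite sumEFin sumr_const card_ord.
Qed.

Definition far_in_tree i (a : R) v : set Omega :=
  in_tree K i v `&` [set w | (a <= `|(tree_label xi i v w)%:~R|)%R].

Lemma far_in_tree_measurable i a v : measurable (far_in_tree i a v).
Proof.
apply: measurableI; first exact: in_tree_measurable.
have := @tree_label_measurable _ _ _ P K xi i v measurableT
  [set x : int | (a <= `|x%:~R|)%R] I.
by rewrite setTI.
Qed.

(** The bound of [far_vertex_le] increases with the generation, so that its value
    in generation [H] serves for all words in [young H]. *)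
Lemma mean_far_mass i H (a : R) : (0 < a)%R ->
  \esum_(v in young H) P (far_in_tree i a v) <=
  (H%:R * (H%:R * step_variance F / a ^+ 2))%:E.
Proof.
move=> a0; have s0 := step_variance_ge0 hF.
have Hs0 : (0 <= H%:R * step_variance F / a ^+ 2)%R.
  by rewrite divr_ge0// ?exprn_ge0 ?mulr_ge0// ltW.
apply: (@le_trans _ _ (\esum_(v in young H)
    ((H%:R * step_variance F / a ^+ 2)%:E * P (in_tree K i v)))).
  apply: le_esum => v vH; apply: (le_trans (far_vertex_le hT hF i v a0)).
  rewrite muleC; apply: lee_wpmul2r => //; rewrite lee_fin.
  rewrite ler_wpM2r ?invr_ge0 ?exprn_ge0 ?(ltW a0)// ler_wpM2r// ler_nat ltnW//.
by rewrite esumZl// mean_young_mass -EFinM mulrC.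
Qed.

Lemma vertices_in_tree (k : seq nat -> nat) v : v \in vertices k -> genealogical_tree k v.
Proof.
rewrite /vertices; have [fT|iT] := pselect (finite_set (genealogical_tree k)).
  by rewrite in_fset_set// inE.
by rewrite /fset_set; case: pselect => //; rewrite inE.
Qed.

Lemma vertices_young i H w v : ~ survives K i H [::] w ->
  v \in vertices (fun u => K i u w) -> (size v < H)%N /\ in_tree K i v w.
Proof.
move=> nH /vertices_in_tree vT; split=> //.
rewrite ltnNge; apply/negP => Hv; apply: nH.
exists (take H v); split; first by rewrite size_takel.
move=> k kH; rewrite /= nth_take// take_takel ?(ltnW kH)//.
by apply: vT; exact: leq_trans Hv.
Qed.

Local Notation tree_area_at w N i := (tree_area R (fun i u => K i u w) N i).

Let measurable_sum_census (I : Type) (s : seq I) H (A : I -> seq nat -> set Omega) :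
  (forall i v, measurable (A i v)) ->
  measurable_fun setT (fun w => \sum_(i <- s) census H (A i) w).
Proof.
by move=> mA; apply: emeasurable_sum => i; exact: measurable_census.
Qed.

Let sum_census_ge0 (I : Type) (s : seq I) H (A : I -> seq nat -> set Omega) w :
  0 <= \sum_(i <- s) census H (A i) w.
Proof. by apply: sume_ge0 => i _; exact: census_ge0. Qed.

Let integral_sum_census (I : Type) (s : seq I) H (A : I -> seq nat -> set Omega) (e : R) :
  (forall i v, measurable (A i v)) ->
  (forall i, \esum_(v in young H) P (A i v) <= e%:E) ->
  \int[P]_w (\sum_(i <- s) census H (A i) w) <= ((size s)%:R * e)%:E.
Proof.
move=> mA Ae; rewrite ge0_integral_sum//; last first.
- by move=> i w _; exact: census_ge0.
- by move=> i; exact: measurable_census.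
apply: (@le_trans _ _ (\sum_(i <- s) e%:E)).
  by apply: lee_sum => i _; rewrite integral_census.
by rewrite sumEFin big_const_seq iter_addr_0 count_predT mulr_natl.
Qed.

(** The exceptional event is the union of four, of probability at most [eps / 4]
    each: some tree survives [h * N] generations; there are too many vertices
    with labels beyond [a], one half of the largest label in the window; the last
    [N / q] trees, whose times are within about [1 / q] of 1, are too large; the
    total size is too large. Outside of it, the area of a tree exceeds its area
    over the window by at most [rho]; and it exceeds [q ^ 2 * (1 - t)] by at most
    [rho] because it is at most [rho] for a late tree, and at most [q] for an
    early one, for which [1 <= q * (1 - t)]. *)
Lemma tree_score_bound (eps rho : R) (q0 : nat) : (0 < eps)%R -> (0 < rho)%R ->
  exists2 q, (q0 <= q)%N & \forall N \near \oo, exists B, [/\ measurable B, P B <= eps%:E &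
    forall w, ~ B w -> forall i, (i < N)%N ->
      (tree_area_at w N i <= score (window_area q) (q%:R ^+ 2)
        (rescaled_densities K xi N w) (tree_time R N i) + rho)%R].
Proof.
move=> eps0 rho0.
have br0 := branching_gt0 hnu; have s20 := step_variance_ge0 hF.
(* This bound gives [N * (branching * h * N)^-1 <= eps / 4]. *)
have [h [h0 hb]] : exists h, (0 < h)%N /\ (4 / (eps * branching nu) <= h%:R)%R.
  exists (Num.truncn (4 / (eps * branching nu))).+1; split => //.
  by rewrite ltW// truncnS_gt.
(* The three bounds are those needed for the far vertices, the total size and
   the late trees, in this order, by Markov's inequality. *)
have [q [qq0 q1 [qa qb qc]]] : exists q, [/\ (q0 <= q)%N, (1 <= q)%N &
    [/\ (32 * h%:R ^+ 2 * step_variance F / (rho * eps) <= q%:R)%R,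
    (8 * h%:R / eps <= q%:R)%R & (16 * h%:R / (rho * eps) <= q%:R)%R]].
  pose M : R := (Num.max (32 * h%:R ^+ 2 * step_variance F / (rho * eps))
    (Num.max (8 * h%:R / eps) (16 * h%:R / (rho * eps))))%R.
  exists (maxn q0 (Num.truncn M).+1); split; [exact: leq_maxl|by rewrite leq_max orbT|].
  have : (M <= (maxn q0 (Num.truncn M).+1)%:R)%R.
    by rewrite (le_trans (ltW (truncnS_gt M)))// ler_nat leq_maxr.
  by rewrite /M !ge_max => /and3P[].
exists q => //; near=> N.
have N4 : (4 <= N)%N by near: N; exact: nbhs_infty_ge.
have Nc : (16 * h%:R / (rho * eps) <= N%:R)%R by near: N; exact: nbhs_infty_ger.
have N0 : (0 < N)%N by exact: leq_trans N4.
have N0R : (0 < N%:R :> R)%R by rewrite ltr0n.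
have q0R : (0 < q%:R :> R)%R by rewrite ltr0n.
have h0R : (0 < h%:R :> R)%R by rewrite ltr0n.
have q1R : (1 <= q%:R :> R)%R by rewrite ler1n.
pose H := (h * N)%N.
pose a : R := (Num.sqrt N%:R * q%:R / 2)%R.
have a0 : (0 < a)%R by rewrite divr_gt0// mulr_gt0// sqrtr_gt0.
have a2 : (a ^+ 2 = N%:R * q%:R ^+ 2 / 4)%R.
  by rewrite /a !exprMn sqr_sqrtr ?ltW// exprVn; congr (_ * _ / _)%R; ring.
pose B1 := \big[setU/set0]_(i < N) survives K i H [::].
pose far w := \sum_(i <- iota 0 N) census H (far_in_tree i a) w.
pose late w := \sum_(i <- [seq (N - j.+1)%N | j <- iota 0 (N %/ q).+1]) census H (in_tree K i) w.
pose total w := \sum_(i <- iota 0 N) census H (in_tree K i) w.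
have survives_measurable i : measurable (survives K i H [::]).
  exact: trees_block_measurable (@survives_block _ _ _ P K xi i H [::]).
have P1 : P B1 <= (eps / 4)%:E.
  apply: (le_trans (@Boole_inequality _ _ _ P (fun i => survives K i H [::]) N _)) => //.
  apply: (@le_trans _ _ (\sum_(i < N) ((1 + branching nu * H%:R)^-1)%:E)).
    by apply: lee_sum => i _; exact: (survival_le hT hnu).
  rewrite sumEFin lee_fin sumr_const card_ord -[leLHS]mulr_natr [leLHS]mulrC.
  have d0 : (0 < 1 + branching nu * H%:R)%R by rewrite ltr_wpDr// mulr_ge0// ltW.
  rewrite ler_pdivrMr// /H natrM.
  have : (4 <= eps * branching nu * h%:R)%R.
    by move: hb; rewrite ler_pdivrMr ?mulr_gt0// mulrC.
  move=> eb; have := ler_wpM2r (ltW N0R) eb; lra.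
have r2 : (0 < rho * N%:R ^+ 2 / 2)%R by rewrite divr_gt0// mulr_gt0// exprn_gt0.
have t2 : (0 < q%:R * N%:R ^+ 2 / 2 :> R)%R by rewrite divr_gt0// mulr_gt0// exprn_gt0.
have mfar : measurable_fun setT far.
  by apply: measurable_sum_census => i v; exact: far_in_tree_measurable.
have mlate : measurable_fun setT late.
  by apply: measurable_sum_census => i v; exact: (@in_tree_measurable _ _ _ P K xi).
have mtotal : measurable_fun setT total.
  by apply: measurable_sum_census => i v; exact: (@in_tree_measurable _ _ _ P K xi).
have far_int : \int[P]_w far w <= (N%:R * (H%:R * (H%:R * step_variance F / a ^+ 2)))%:E.
  rewrite -[X in (X%:R * _)%R](size_iota 0 N).
  apply: integral_sum_census => [j v|j]; first exact: far_in_tree_measurable.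
  exact: mean_far_mass.
have late_int : \int[P]_w late w <= ((N %/ q).+1%:R * H%:R)%:E.
  rewrite -[X in (X%:R * _)%R](size_iota 0 (N %/ q).+1).
  rewrite -(size_map (fun j => (N - j.+1)%N)).
  apply: integral_sum_census => [j v|j]; first exact: (@in_tree_measurable _ _ _ P K xi).
  by rewrite mean_young_mass.
have total_int : \int[P]_w total w <= (N%:R * H%:R)%:E.
  rewrite -[X in (X%:R * _)%R](size_iota 0 N).
  apply: integral_sum_census => [j v|j]; first exact: (@in_tree_measurable _ _ _ P K xi).
  by rewrite mean_young_mass.
have [mB2 P2] := markov_bound mfar (fun w => sum_census_ge0 _ _ _ w) r2 far_int.
have [mB3 P3] := markov_bound mlate (fun w => sum_census_ge0 _ _ _ w) r2 late_int.
have [mB4 P4] := markov_bound mtotal (fun w => sum_census_ge0 _ _ _ w) t2 total_int.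
set B2 := [set w | _] in mB2 P2; set B3 := [set w | _] in mB3 P3; set B4 := [set w | _] in mB4 P4.
have {}P2 : P B2 <= (eps / 4)%:E.
  apply: (le_trans P2); rewrite lee_fin ler_pdivrMr// a2 /H natrM.
  have -> : (N%:R * (h%:R * N%:R * (h%:R * N%:R * step_variance F /
      (N%:R * q%:R ^+ 2 / 4))) = 4 * h%:R ^+ 2 * step_variance F * N%:R ^+ 2 / q%:R ^+ 2 :> R)%R.
    by field; rewrite !gt_eqF.
  rewrite ler_pdivrMr ?exprn_gt0//.
  move: qa; rewrite ler_pdivrMr ?mulr_gt0// => qa.
  have qq : (q%:R * (rho * eps) <= q%:R ^+ 2 * (rho * eps))%R.
    by rewrite ler_wpM2r ?mulr_ge0 ?(ltW rho0) ?(ltW eps0)// expr2 ler_peMl// ltW.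
  have := ler_wpM2r (sqr_ge0 (N%:R : R)) (le_trans qa qq).
  lra.
have {}P3 : P B3 <= (eps / 4)%:E.
  apply: (le_trans P3); rewrite lee_fin ler_pdivrMr// /H natrM -natr1.
  move: qc Nc; rewrite !ler_pdivrMr ?mulr_gt0// => qc Nc'.
  have Nq : ((N %/ q)%:R * q%:R <= N%:R :> R)%R by rewrite -natrM ler_nat leq_trunc_div.
  have e1 : ((N %/ q)%:R * (16 * h%:R) <= N%:R * (rho * eps) :> R)%R.
    apply: (@le_trans _ _ ((N %/ q)%:R * (q%:R * (rho * eps)))%R); first by rewrite ler_wpM2l.
    by rewrite mulrA ler_wpM2r// mulr_ge0// ltW.
  have := ler_wpM2r (ltW N0R) e1; have := ler_wpM2r (ltW N0R) Nc'.
  lra.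
have {}P4 : P B4 <= (eps / 4)%:E.
  apply: (le_trans P4); rewrite lee_fin ler_pdivrMr// /H natrM.
  move: qb; rewrite ler_pdivrMr// => qb.
  have := ler_wpM2r (sqr_ge0 (N%:R : R)) qb.
  lra.
have mB1 : measurable B1.
  by rewrite /B1 -(bigcup_mkord N (fun j => survives K j H [::])); exact: bigcup_measurable.
exists (B1 `|` B2 `|` B3 `|` B4); split.
- by do 3 apply: measurableU => //.
- have m12 : measurable (B1 `|` B2) by exact: measurableU.
  have m123 : measurable (B1 `|` B2 `|` B3) by exact: measurableU.
  have -> : (eps = eps / 4 + eps / 4 + eps / 4 + eps / 4)%R by lra.
  apply: (le_trans (measureU2 P m123 mB4)); rewrite EFinD; apply: leeD => //.
  apply: (le_trans (measureU2 P m12 mB3)); rewrite EFinD; apply: leeD => //.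
  by apply: (le_trans (measureU2 P mB1 mB2)); rewrite EFinD; apply: leeD.
move=> w /not_orP[/not_orP[/not_orP[nB1 nB2] nB3] nB4] i iN.
have nH : ~ survives K i H [::] w.
  by move=> sw; apply: nB1; rewrite /B1 -(bigcup_mkord N (fun j => survives K j H [::])); exists i.
have [_ /andP[c0 c2]] := unit_tent_areaE R.
(* [unit_tent_area] is at most 2, whence the factor [/ 2]. *)
have kappa (n : nat) (x : R) : (n%:R <= x * N%:R ^+ 2 / 2)%R ->
    (unit_tent_area R / N%:R ^+ 2 * n%:R <= x)%R.
  move=> nx; rewrite mulrAC ler_pdivrMr ?exprn_gt0//.
  apply: (@le_trans _ _ (2 * n%:R)%R); first by rewrite ler_wpM2r.
  lra.
have from_sum (s : seq nat) (A : nat -> seq nat -> set Omega) (x : R) (n : nat) : i \in s ->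
    n%:R%:E <= census H (A i) w ->
    ~ (x%:E <= \sum_(j <- s) census H (A j) w) -> (n%:R <= x)%R.
  move=> si nA /negP; rewrite -ltNge => sx.
  rewrite -lee_fin (le_trans nA)// (le_trans _ (ltW sx))//.
  rewrite (big_rem i)//= leeDl//; exact: sum_census_ge0.
have sizeE : (tree_size (fun u => K i u w))%:R%:E <= census H (in_tree K i) w.
  rewrite /tree_size -[X in X%:R]count_predT; apply: count_le_census => v vV _.
  exact: vertices_young nH vV.
rewrite -lerBlDr /score le_min; apply/andP; split.
  rewrite (jump_tree_time _ _ _ N0).
  apply: (le_trans _ (@window_area_profile_ge R _ _ N N0 q i)); rewrite lerB//.
  apply: kappa; apply: (from_sum (iota 0 N) (fun i => far_in_tree i a)) nB2.
    by rewrite mem_iota.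
  apply: count_le_census => v vV lv; have [vH vT] := vertices_young nH vV.
  split=> //; split=> //=; rewrite /a.
  have sN2 : (2 <= Num.sqrt (N%:R : R))%R.
    by rewrite -ler_sqr ?nnegrE// sqr_sqrtr// -natrX ler_nat.
  have : (2 <= Num.sqrt (N%:R : R) * q%:R)%R.
    by rewrite -[leLHS]mulr1; apply: ler_pM.
  by move: lv; rewrite /tree_label; lra.
(* Only late trees have a small factor [1 - t] in their score. *)
have [late_i|early_i] := leqP N (i + (N %/ q).+1).
  apply: (@le_trans _ _ 0%R); last first.
    by rewrite mulr_ge0// subr_ge0 /tree_time ler_pdivrMr// mul1r ler_nat.
  rewrite subr_le0; apply: kappa.
  apply: (from_sum _ (in_tree K)) sizeE nB3.
  apply/mapP; exists (N - i.+1)%N; last by rewrite subnSK// subKn// ltnW.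
  by rewrite mem_iota add0n leq0n /= ltn_subLR// addSn ltnS.
apply: (@le_trans _ _ q%:R).
  rewrite lerBlDr (le_trans (y := q%:R))//; last by rewrite lerDl ltW.
  apply: kappa; apply: (from_sum _ (in_tree K)) sizeE nB4.
  by rewrite mem_iota.
rewrite expr2 -mulrA ler_peMr// /tree_time.
have -> : (1 - i.+1%:R / N%:R = (N - i.+1)%:R / N%:R :> R)%R.
  by rewrite natrB// mulrBl divff// gt_eqF.
rewrite mulrA ler_pdivlMr// mul1r -natrM ler_nat.
rewrite (leq_trans (ltnW (ltn_ceil N q1)))// mulnC leq_mul2l.
by apply/orP; right; rewrite ltn_subRL addSn -addnS.
Unshelve. all: by end_near. Qed.

End TreeMasses.

(** * Measurability of the ordered jumps *)

Section PrelimitMeasurability.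
Context {d : measure_display} {Omega : measurableType d} {R : realType}.
Variables (P : probability Omega R).
Variables (K : nat -> seq nat -> {RV P >-> nat}).
Variables (xi : nat -> seq nat -> nat -> {RV P >-> int}).

Let measurableS : sigma_algebra setT (@measurable _ Omega).
Proof. exact: sigma_algebra_measurable. Qed.

(** Being equal to a given set of words is a countable conjunction of conditions on
    the tree. The empty set stands for all infinite trees, an event that is the
    complement of the union of countably many of these. *)
Lemma dmeas_vertices i : dmeas measurable (fun w => vertices (fun u => K i u w)).
Proof.
apply: (dmeas_fiber measurableS) => S.
have mT v : measurable [set w | genealogical_tree (fun u => K i u w) v].
  rewrite (_ : [set w | _] = \bigcap_(k in `I_(size v))
      K i (take k v) @^-1` [set n | (nth 0%N v k < n)%N]).
    by apply: (sigma_bigcap measurableS) => k _; exact: measurable_funPTI.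
  by apply/seteqP; split.
have tree_is D : measurable [set w | genealogical_tree (fun u => K i u w) = D].
  rewrite (_ : [set w | _] = \bigcap_(v in [set: seq nat])
     (if v \in D then [set w | genealogical_tree (fun u => K i u w) v]
      else ~` [set w | genealogical_tree (fun u => K i u w) v])).
    apply: (sigma_bigcap measurableS) => v _; case: ifPn => _; first exact: mT.
    exact: measurableC.
  apply/seteqP; split => [w /= <- v _|w h].
    by case: ifPn; [exact: set_mem|move=> /negP h Tv; apply: h; exact/mem_set].
  apply/seteqP; split => v; have := h v I.
    by case: ifPn => [vD _ _|_ /= nT /nT//]; exact: set_mem.
  by case: ifPn => [//|vD _ Dv]; move/negP: vD => []; exact/mem_set.
have [->|S0] := eqVneq S fset0; last first.
  rewrite (_ : _ @^-1` _ = [set w | genealogical_tree (fun u => K i u w) = [set` S]]) //.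
  apply/seteqP; split => w /=; rewrite /vertices.
    rewrite {1}/fset_set; case: pselect => [fT <-|_ SE]; last by rewrite SE eqxx in S0.
    by case: cid.
  by move=> ->; rewrite set_fsetK.
rewrite (_ : _ @^-1` _ = ~` (\bigcup_(S in [set S : {fset seq nat} | S != fset0])
    [set w | genealogical_tree (fun u => K i u w) = [set` S]])).
  apply: measurableC; apply: (sigma_bigcup measurableS) => D _; exact: tree_is.
apply/seteqP; split => w /=.
  rewrite /vertices => v0 [D /= D0 TD]; move: v0; rewrite TD set_fsetK => D0'.
  by rewrite D0' eqxx in D0.
move=> h; apply/eqP/negPn/negP => v0; apply: h; exists (vertices (fun u => K i u w)) => //=.
move: v0; rewrite /vertices /fset_set; case: pselect => [fT _|_]; last by rewrite eqxx.
by case: cid.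
Qed.

Lemma dmeas_label i v : dmeas measurable (tree_label xi i v).
Proof.
move=> A; rewrite -[X in measurable X]setTI.
exact: (@tree_label_measurable _ _ _ P K xi).
Qed.

Definition vertex_labels i (w : Omega) : seq int :=
  [seq tree_label xi i v w | v <- (vertices (fun u => K i u w) : seq (seq nat))].

Lemma dmeas_vertex_labels i : dmeas measurable (vertex_labels i).
Proof.
apply: (@dmeas_bind _ _ measurableS _ _ _ (fun (S : {fset seq nat}) w =>
  [seq tree_label xi i v w | v <- (S : seq (seq nat))]) (dmeas_vertices i)) => S.
by apply: (dmeas_map measurableS) => v _; exact: dmeas_label.
Qed.

Let by_size (z : nat -> nat) : rel nat := fun i i' =>
  (z i' < z i)%N || ((z i == z i') && (i <= i')%N).

(** Thus the sorted list factors through the finite list of the sizes. *)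
Let eq_sort_by_size (z z' : nat -> nat) (s : seq nat) : {in s, z =1 z'} ->
  sort (by_size z) s = sort (by_size z') s.
Proof.
move=> zz'.
have tot y : total (by_size y) by move=> i j; rewrite /by_size; lia.
apply: (@sorted_eq _ (by_size z')).
- by move=> j i k; rewrite /by_size; lia.
- by move=> i j; rewrite /by_size; lia.
- rewrite -(@eq_in_sorted _ (mem s) (by_size z)).
  + exact: sort_sorted.
  + by move=> i j /= si sj; rewrite /by_size !zz'.
  + by apply/allP => i; rewrite mem_sort.
- exact: sort_sorted.
- by rewrite perm_sort perm_sym perm_sort.
Qed.

Lemma dmeas_trees_by_size N : dmeas measurable (fun w => trees_by_size (fun i u => K i u w) N).
Proof.
pose sizes w := [seq tree_size (fun u => K i u w) | i <- iota 0 N].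
apply: (dmeas_eq (f := (fun s => sort (by_size (nth 0%N s)) (iota 0 N)) \o sizes)).
  move=> w; rewrite /sizes /trees_by_size /=; apply: eq_sort_by_size => i.
  by rewrite mem_iota add0n /= => iN; rewrite (nth_map 0%N) ?size_iota// nth_iota.
apply: dmeas_comp; apply: (dmeas_map measurableS) => i _.
by apply: (dmeas_comp (fun S : {fset seq nat} => #|` S|)); exact: dmeas_vertices.
Qed.

Definition jump_labels N j w : seq int :=
  vertex_labels (nth 0%N (trees_by_size (fun i u => K i u w) N) j) w.

Lemma dmeas_jump_labels N j : dmeas measurable (jump_labels N j).
Proof.
apply: (@dmeas_bind _ _ measurableS _ _ _ (fun i w => vertex_labels i w)) => [|i].
  by apply: (dmeas_comp (fun s => nth 0%N s j)); exact: dmeas_trees_by_size.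
exact: dmeas_vertex_labels.
Qed.

(** Through the labels of the vertices of the [m] largest trees, the tuple factors
    through a countable type; so the preimage of every set is measurable. *)
Lemma random_ordered_jumps m N :
  @random_element _ Omega {ptws 'I_m -> c0 R}
    (fun w => fun k : 'I_m => ordered_jumps_of_densities K xi N k w).
Proof.
suff : dmeas measurable (fun w => (fun k : 'I_m => ordered_jumps_of_densities K xi N k w)
    : {ptws 'I_m -> c0 R}) by move=> mJ U _; exact: mJ.
have [->|N0] := posnP N.
  apply: (dmeas_eq _ (dmeas_cst measurableS (fun=> 0))) => w; apply/funext => k.
  rewrite /ordered_jumps_of_densities /ordered_jump /=.
  have p0 : (0%N%:R : R) `^ (- (3 / 2)) = 0 by rewrite powR0// oppr_eq0; lra.
  by apply: c0_eqP => x; rewrite c0B /= /rescaled_occupation p0 !mul0r subrr.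
have sN : 0 < Num.sqrt (N%:R : R) by rewrite sqrtr_gt0 ltr0n.
pose profile (s : seq int) : c0 R :=
  \sum_(l <- s) (N%:R `^ (- (3 / 2))) *: tent sN l.
pose J (s : seq (seq int)) : {ptws 'I_m -> c0 R} := fun k => profile (nth [::] s k).
apply: (dmeas_eq (f := J \o (fun w => [seq jump_labels N k w | k <- iota 0 m]))).
  move=> w; apply/funext => k; rewrite /J /=.
  rewrite (nth_map 0%N) ?size_iota// nth_iota//.
  rewrite /ordered_jumps_of_densities ordered_jumpE// /tree_profile /profile.
  rewrite /jump_labels /vertex_labels big_map; apply: eq_bigr => v _.
  by congr (_ *: _); apply: c0_eqP => x; rewrite !tentE.
by apply: dmeas_comp; apply: (dmeas_map measurableS) => k _; exact: dmeas_jump_labels.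
Qed.

End PrelimitMeasurability.

(** * Random elements of finite products *)

Section FiniteProducts.
Variables (R : realType) (V : normedModType R) (m : nat).

(** The topology of pointwise convergence is a supremum of coordinate topologies;
    over finitely many coordinates a common radius exists. *)
Lemma ptws_box (x : {ptws 'I_m -> V}) (A : set {ptws 'I_m -> V}) : nbhs x A ->
  exists2 e : R, 0 < e & forall z : 'I_m -> V, (forall k, `|x k - z k| < e) -> A z.
Proof.
pose box (e : R) : set {ptws 'I_m -> V} := [set z | forall k, `|x k - z k| < e].
pose B := filter_from [set e : R | 0 < e] box.
have FB : Filter B.
  apply: filter_from_filter; first by exists 1 => /=.
  move=> e e' /= e0 e'0; exists (Num.min e e'); first by rewrite /= lt_min e0.
  by move=> z zP; split=> k; have := zP k; rewrite lt_min => /andP[].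
have Bx : B --> (x : {ptws 'I_m -> V}).
  apply/cvg_sup => k; rewrite cvg_image; last first.
    by rewrite eqEsubset; split=> v // _; exists (fun=> v).
  move=> W /= /nbhs_ballP[e /= e0 eW]; exists ((fun f => f k) @^-1` W).
    by exists e => // z ze; apply: eW; rewrite -ball_normE; exact: ze.
  rewrite eqEsubset; split => [v [z zW <-]//|v vW].
  by exists (fun=> v).
by move=> /Bx[e /= e0 eA]; exists e => // z ze; apply: eA.
Qed.

(** A dense sequence makes the countably many boxes centred at it a base of the
    finite product, so that the coordinates determine the Borel structure. *)
Lemma random_tuple (D : countType) (e : D -> V) d (Omega : measurableType d)
    (J : 'I_m -> Omega -> V) :
  (forall (x : V) (r : R), 0 < r -> exists i, `|x - e i| < r) ->
  (forall k, random_element (J k)) ->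
  @random_element _ Omega {ptws 'I_m -> V} (fun w => J ^~ w).
Proof.
move=> e_dense Jm U oU.
pose box (p : nat * {ffun 'I_m -> D}) : set ('I_m -> V) :=
  [set z | forall k, `|e (p.2 k) - z k| < p.1.+1%:R^-1].
have -> : (fun w => J ^~ w : {ptws 'I_m -> V}) @^-1` U =
    \bigcup_(p in [set p | box p `<=` U])
      \bigcap_(k in [set: 'I_m]) J k @^-1` ball (e (p.2 k)) p.1.+1%:R^-1.
  apply/seteqP; split => [w /= Uw|w [p /= pU pw]]; last first.
    by apply: pU => k; have := pw k I; rewrite /= -ball_normE.
  have [r r0 rU] := ptws_box (open_nbhs_nbhs (conj oU Uw)).
  have [n nr] : exists n : nat, n.+1%:R^-1 < r / 2.
    have r2 : 0 < r / 2 by rewrite divr_gt0.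
    by have [n _ /(_ n (leqnn n))] := near_infty_natSinv_lt (PosNum r2); exists n.
  have /choice[i iP] : forall k, exists i, `|J k w - e i| < n.+1%:R^-1.
    by move=> k; exact: e_dense.
  exists (n, [ffun k => i k]) => [z zP|k _] /=.
    apply: rU => k /=; apply: (le_lt_trans (ler_distD (e (i k)) _ _)).
    have := iP k; have := zP k; rewrite /= ffunE => ez Je.
    by rewrite (splitr r); apply: ltrD; [exact: lt_trans nr|exact: lt_trans nr].
  by rewrite -ball_normE /= ffunE distrC.
have measurableS : sigma_algebra setT (@measurable _ Omega).
  exact: sigma_algebra_measurable.
apply: (sigma_bigcup measurableS) => p _; apply: (sigma_bigcap measurableS) => k _.
by apply: Jm; exact: ball_open.
Qed.

End FiniteProducts.

(** * Separability of the continuous functions vanishing at infinity *)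

Section Separability.
Variable R : realType.

Lemma c0_small_at_infinity (f : c0 R) (e : R) : 0 < e ->
  exists2 M, 0 < M & forall x, M <= `|x| -> `|f x| < e.
Proof.
move=> e0; have [_ pf nf] := c0P f.
move/cvgrPdist_lt : pf => /(_ _ e0)[M1 [_ h1]].
move/cvgrPdist_lt : nf => /(_ _ e0)[M2 [_ h2]].
have p1 := normr_ge0 M1; have p2 := normr_ge0 M2.
exists (`|M1| + `|M2| + 1); first lra.
move=> x; have := ler_norm M1; have := ler_norm (- M2); rewrite normrN => n2 n1.
rewrite ler_normr => /orP[xM|xM].
  by have := h1 x; rewrite sub0r normrN; apply; lra.
by have := h2 x; rewrite sub0r normrN; apply; lra.
Qed.

(** Heine's theorem, extended to the whole line by the smallness at infinity. *)
Lemma c0_uniform_continuity (f : c0 R) (e : R) : 0 < e ->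
  exists n : nat, forall x y, `|x - y| <= n.+1%:R^-1 -> `|f x - f y| < e.
Proof.
move=> e0; have e2 : 0 < e / 2 by rewrite divr_gt0.
have [M M0 fM] := c0_small_at_infinity f e2.
have /compact_near_coveringP near_cov := @segment_compact R (- (M + 1)) (M + 1).
pose Q (n : nat) (x : R) := forall y, `|x - y| <= n.+1%:R^-1 -> `|f x - f y| < e.
have [] := @near_cov nat \oo Q _ _.
  move=> x _; have /cvgrPdist_lt/(_ _ e2)/nbhs_ballP[d /= d0 dP] := @c0_continuous _ f x.
  have d2 : 0 < d / 2 by rewrite divr_gt0.
  exists (ball x (d / 2), [set n : nat | n.+1%:R^-1 < d / 2]).
    split=> /=; first exact: nbhsx_ballx.
    exact: (near_infty_natSinv_lt (PosNum d2)).
  move=> [x' n] /= [xx' nd] y x'y; rewrite /ball/= in xx'.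
  have fx' : `|f x - f x'| < e / 2 by apply: dP; rewrite /ball/=; lra.
  have fy : `|f x - f y| < e / 2.
    apply: dP; rewrite /ball/=; apply: (le_lt_trans (ler_distD x' _ _)).
    by rewrite (splitr d) ltrD//; exact: le_lt_trans nd.
  apply: (le_lt_trans (ler_distD (f x) _ _)); rewrite (distrC (f x')); lra.
move=> n _ /(_ n (leqnn n)) nQ; exists n => x y xy.
have [xK|xK] := boolP (x \in `[- (M + 1), M + 1]); first exact: nQ.
have n1 : n.+1%:R^-1 <= 1 :> R by rewrite invf_le1// ler1n.
have Mx : M + 1 <= `|x|.
  by rewrite leNgt; apply: contra xK => /ltW; rewrite ler_norml in_itv.
have fx : `|f x| < e / 2 by apply: fM; lra.
have fy : `|f y| < e / 2.
  have xy1 := le_trans xy n1.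
  by apply: fM; have := lerB_dist x y; lra.
apply: (le_lt_trans (ler_normB _ _)); lra.
Qed.

(** Piecewise linear functions with finitely many nodes in the multiples of
    [p.1.+1%:R^-1] and rational values there; they are countably many. *)
Definition tent_combination (p : nat * seq (int * rat)) : c0 R :=
  \sum_(iq <- p.2) ratr iq.2 *: tent (ltr0Sn R p.1) iq.1.

Let tent_combinationE p x : tent_combination p x =
  linear_interpolation (fun j => \sum_(iq <- p.2) ratr iq.2 * (iq.1 == j)%:R) (p.1.+1%:R * x).
Proof.
rewrite /tent_combination c0_sum; under eq_bigr do rewrite c0Z tentE -linear_interpolation_delta.
rewrite /linear_interpolation !mulr_sumr -big_split/=; apply: eq_bigr => iq _.
by ring.
Qed.

(** At every point the interpolation is a convex combination of its values at the
    two neighbouring nodes, where it is close to [f] by uniform continuity, and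
    by the smallness of [f] at infinity beyond the last nodes. *)
Lemma tent_combination_dense (f : c0 R) (e : R) : 0 < e ->
  exists p, `|f - tent_combination p| < e.
Proof.
move=> e0; have e4 : 0 < e / 4 by rewrite divr_gt0.
have [M M0 fM] := c0_small_at_infinity f e4.
have [n fn] := c0_uniform_continuity f e4.
have n0 : 0 < n.+1%:R :> R by [].
have /choice[q qP] : forall i : int, exists q : rat, `|ratr q - f (i%:~R / n.+1%:R)| < e / 4.
  move=> i; have [|q] := @rat_in_itvoo R (f (i%:~R / n.+1%:R) - e / 4) (f (i%:~R / n.+1%:R) + e / 4).
    lra.
  by rewrite in_itv /= => /andP[? ?]; exists q; rewrite ltr_norml; lra.
pose A := (Num.truncn (M * n.+1%:R)).+1.
have MA : M * n.+1%:R < A%:R by exact: truncnS_gt.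
pose s : seq int := [seq k%:Z - A%:Z | k <- iota 0 (2 * A).+1].
have us : uniq s by rewrite map_inj_uniq ?iota_uniq// => k l /addIr [].
have sP (i : int) : (i \in s) = (`|i| <= A%:Z).
  apply/mapP/idP => [[k]|iA]; first by rewrite mem_iota add0n => /andP[_ ?] ->; lia.
  by exists (absz (i + A%:Z)); [rewrite mem_iota add0n; lia|lia].
pose X (i : int) : R := if i \in s then ratr (q i) else 0.
exists (n, [seq (i, q i) | i <- s]); apply: (@le_lt_trans _ _ (e / 2)); last by lra.
apply: c0_norm_le => x; rewrite c0B tent_combinationE /=.
have XE j : \sum_(iq <- [seq (i, q i) | i <- s]) ratr iq.2 * (iq.1 == j)%:R = X j.
  rewrite big_map /X; case: ifPn => js.
    rewrite (bigD1_seq j)//= eqxx mulr1 big1 ?addr0// => i ij.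
    by rewrite (negbTE ij) mulr0.
  rewrite big1_seq// => i /= is_; case: eqP => [ij|]; last by rewrite mulr0.
  by rewrite -ij is_ in js.
rewrite /linear_interpolation !XE; set u := n.+1%:R * x; set j := Num.floor u.
have /andP[ju uj] := floor_itv u; rewrite -/j intrD in ju uj.
have near_node (i : int) : `|u - i%:~R| <= 1 -> `|f x - X i| <= e / 2.
  move=> ui; have xi : `|x - i%:~R / n.+1%:R| <= n.+1%:R^-1.
    have -> : x - i%:~R / n.+1%:R = (u - i%:~R) / n.+1%:R.
      by rewrite /u mulrBl mulrAC divff ?mul1r// gt_eqF.
    by rewrite normrM [X in _ * X]gtr0_norm ?invr_gt0// ler_piMl// invr_ge0 ltW.
  have fxi := fn _ _ xi.
  rewrite /X; case: ifPn => [_|].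
    have := qP i; rewrite distrC => qi; apply: (le_trans (ler_distD (f (i%:~R / n.+1%:R)) _ _)).
    by lra.
  rewrite sP -ltNge => iA; rewrite subr0.
  have Mi : M <= `|i%:~R / n.+1%:R|.
    rewrite normrM [X in _ * X]gtr0_norm ?invr_gt0// ler_pdivlMr//.
    apply: (le_trans (ltW MA)); rewrite -intr_norm -[A%:R]/(A%:Z%:~R) ler_int ltW//.
  have := fM _ Mi; have := ler_distD (f (i%:~R / n.+1%:R)) (f x) 0; rewrite !subr0; lra.
have h1 : `|f x - X j| <= e / 2 by apply: near_node; rewrite ger0_norm; lra.
have h2 : `|f x - X (j + 1)| <= e / 2.
  by apply: near_node; rewrite intrD ler0_norm; lra.
move: h1 h2; move: (X j) (X (j + 1)) => a b h1 h2.
have -> : f x - ((1 - (u - j%:~R)) * a + (u - j%:~R) * b) =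
  (1 - (u - j%:~R)) * (f x - a) + (u - j%:~R) * (f x - b) by ring.
have t0 : 0 <= u - j%:~R by lra.
have t1 : 0 <= 1 - (u - j%:~R) by lra.
apply: (le_trans (ler_normD _ _)); rewrite !normrM (ger0_norm t0) (ger0_norm t1).
move: (u - j%:~R) t0 t1 => t t0 t1.
have k1 := ler_wpM2l t1 h1; have k2 := ler_wpM2l t0 h2.
lra.
Qed.

End Separability.

(** * Means of bounded functions *)

Section BoundedMeans.
Context {d : measure_display} {Omega : measurableType d} {R : realType}.
Variable P : probability Omega R.

Lemma measurable_random_element (S : topologicalType) (X : Omega -> S) (h : S -> R) :
  random_element X -> continuous h -> measurable_fun setT (h \o X).
Proof.
move=> mX ch; apply: (measurability _ (RGenOInfty.measurableE R)) => _ [_ [x ->] <-].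
rewrite setTI comp_preimage; apply: mX.
by move/continuousP: ch; apply; exact: interval_open.
Qed.

Lemma bounded_integrable (f : Omega -> R) (M : R) : measurable_fun setT f ->
  (forall w, `|f w| <= M) -> P.-integrable setT (EFin \o f).
Proof.
move=> mf fM; apply: measurable_bounded_integrable => //.
  by rewrite [ltLHS]probability_setT ltry.
exists M; split; first exact: num_real.
by move=> x Mx w _ /=; exact: le_trans (fM w) (ltW Mx).
Qed.

Lemma expectation_Rintegral (f : Omega -> R) (M : R) : measurable_fun setT f ->
  (forall w, `|f w| <= M) -> ('E_P[f] = (\int[P]_w f w)%:E)%E.
Proof.
move=> mf fM; rewrite unlock fineK//.
exact: integrable_fin_num (bounded_integrable mf fM).
Qed.

Lemma Rintegral_prob_cst (c : R) : \int[P]_w c = c.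
Proof. by rewrite Rintegral_cst// [X in fine X]probability_setT mulr1. Qed.

End BoundedMeans.

Lemma cvg_expectationE (R : realType) d d' (Omega : measurableType d)
    (Omega' : measurableType d') (P : probability Omega R) (P' : probability Omega' R)
    (f : nat -> Omega -> R) (f' : Omega' -> R) (M : R) :
  (forall N, measurable_fun setT (f N)) -> measurable_fun setT f' ->
  (forall N w, `|f N w| <= M) -> (forall w, `|f' w| <= M) ->
  ('E_P[f N] @[N --> \oo] --> 'E_P'[f'])%E <->
  \int[P]_w f N w @[N --> \oo] --> \int[P']_w f' w.
Proof.
move=> mf mf' fM f'M; rewrite (expectation_Rintegral P' mf' f'M).
have -> : (fun N => 'E_P[f N])%E = (fun N => (\int[P]_w f N w)%:E).
  by apply/funext => N; exact: expectation_Rintegral (mf N) (fM N).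
split=> [/fine_cvg//|fcvg]; apply: cvg_EFin => //; exact: nearW.
Qed.

(** * Lower bound for the means of nonnegative functions *)

Section LowerBound.
Variables (R : realType).
Variables (nu : probability nat R) (F : probability int R).
Hypothesis hnu : critical_offspring nu.
Hypothesis hF : centered_span1 F.
Variables (d : measure_display) (Omega : measurableType d) (P : probability Omega R).
Variables (K : nat -> seq nat -> {RV P >-> nat}).
Variables (xi : nat -> seq nat -> nat -> {RV P >-> int}).
Hypothesis hT : iid_labeled_trees nu F K xi.
Variables (d' : measure_display) (Omega' : measurableType d').
Variables (P' : probability Omega' R) (g : Omega' -> cadlag (c0 R)).
Hypothesis hg : cvg_in_law P P' (rescaled_densities K xi) g.
Hypothesis g_nondecreasing : {ae P', forall w, forall s t x : R,
  0 <= s -> s <= t -> g w s x <= g w t x}.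
Variable J : nat -> Omega' -> c0 R.
Hypothesis J_random : forall k, random_element (J k).
Hypothesis hJ : {ae P', forall w, ordered_jumps (g w) (J ^~ w)}.
Variable m : nat.

Local Notation X N := (fun w => (fun k : 'I_m => ordered_jumps_of_densities K xi N k w)
  : {ptws 'I_m -> c0 R}).
Local Notation Y := (fun w => (fun k : 'I_m => J k w) : {ptws 'I_m -> c0 R}).

Lemma random_limit_jumps : random_element Y.
Proof.
apply: (random_tuple (e := @tent_combination R)) => [f r r0|k].
  exact: tent_combination_dense.
exact: J_random.
Qed.

Variables (h : {ptws 'I_m -> c0 R} -> R) (C : R).
Hypothesis ch : continuous h.
Hypothesis h0 : forall x, 0 <= h x.
Hypothesis hC : forall x, h x <= C.

Let C0 : 0 <= C. Proof. exact: le_trans (h0 (fun=> 0)) (hC _). Qed.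

Let hN x : `|h x| <= C. Proof. by rewrite ger0_norm. Qed.

Let mhX N : measurable_fun setT (h \o X N).
Proof.
exact: (measurable_random_element (X := X N) (@random_ordered_jumps _ _ _ P K xi m N) ch).
Qed.

Let mhY : measurable_fun setT (h \o Y).
Proof. exact: measurable_random_element random_limit_jumps ch. Qed.

Let G (q n : nat) : cadlag (c0 R) -> R :=
  ranked_inf (window_area q) (q%:R ^+ 2) n.+1%:R C h.

Let G_continuous q n : (0 < q)%N -> continuous (G q n).
Proof.
move=> q0; apply: (@ranked_inf_continuous _ _ _ _ (2 * q%:R)) => //.
- exact: window_area0.
- exact: window_area_lip.
- by rewrite exprn_gt0// ltr0n.
Qed.

Let G_bounded q n y : `|G q n y| <= C.
Proof. by rewrite ger0_norm ?ranked_inf_leC// ranked_inf_ge0. Qed.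

Let G_prelimit (q n N : nat) (rho : R) w : (0 < N)%N -> (m <= N)%N -> 0 <= rho ->
  (forall i, (i < N)%N -> tree_area R (fun i u => K i u w) N i <=
     score (window_area q) (q%:R ^+ 2) (rescaled_densities K xi N w) (tree_time R N i) + rho) ->
  G q n (rescaled_densities K xi N w) <= h (X N w) + n.+1%:R * rho.
Proof. by move=> N0 mN rho0 area; apply: ranked_inf_prelimit. Qed.

Let h_box (w : Omega') (e : R) : 0 < e -> exists2 r, 0 < r &
  forall x : 'I_m -> c0 R, (forall k, `|x k - J k w| < r) -> h (Y w) - e < h x.
Proof.
move=> e0; have /ch/ptws_box[r r0 rP] : nbhs (h (Y w)) (ball (h (Y w)) e).
  exact: nbhsx_ballx.
exists r => // x xr; have : ball (h (Y w)) e (h x).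
  by apply: rP => k /=; rewrite distrC; exact: xr.
by rewrite /ball/= => /ltr_normlW; lra.
Qed.

(** On [B] the functional is bounded by [C], off [B] by [ranked_inf_prelimit]. *)
Let mean_prelimit q n N (B : set Omega) (rho p : R) : (0 < q)%N -> (0 < N)%N -> (m <= N)%N ->
  0 <= rho -> measurable B -> (P B <= p%:E)%E ->
  (forall w, ~ B w -> forall i, (i < N)%N -> tree_area R (fun i u => K i u w) N i <=
     score (window_area q) (q%:R ^+ 2) (rescaled_densities K xi N w) (tree_time R N i) + rho) ->
  \int[P]_w G q n (rescaled_densities K xi N w) <=
  \int[P]_w h (X N w) + n.+1%:R * rho + C * p.
Proof.
move=> q0 N0 mN rho0 mB Bp area.
have mG : measurable_fun setT (fun w => G q n (rescaled_densities K xi N w)).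
  have [rX _ _] := hg; exact: (measurable_random_element (rX N) (@G_continuous _ n q0)).
have iG := bounded_integrable P mG (fun w => G_bounded q n _).
have ihX := bounded_integrable P (mhX N) (fun w => hN _).
have icst (c : R) : P.-integrable setT (EFin \o (fun _ : Omega => c)).
  exact: (bounded_integrable P (M := `|c|)).
have mI : measurable_fun setT (fun w => C * \1_B w : R).
  by apply: measurable_funM => //; exact: measurable_indic.
have iB : P.-integrable setT (EFin \o (fun w => C * \1_B w : R)).
  apply: (bounded_integrable P (M := C)) => // w.
  by rewrite normrM !ger0_norm// ler_piMr// indicE; case: (_ \in _).
have iB1 : P.-integrable setT (EFin \o (\1_B : Omega -> R)).
  apply: (bounded_integrable P (M := 1)); first exact: measurable_indic.
  by move=> w; rewrite ger0_norm// indicE; case: (_ \in _).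
have ihXc : P.-integrable setT (EFin \o (fun w => h (X N w) + n.+1%:R * rho)).
  exact: (integrableD measurableT ihX (icst _)).
have -> : \int[P]_w h (X N w) + n.+1%:R * rho = \int[P]_w (h (X N w) + n.+1%:R * rho).
  by rewrite RintegralD// Rintegral_prob_cst.
apply: (@le_trans _ _ (\int[P]_w (h (X N w) + n.+1%:R * rho + C * \1_B w))).
  apply: le_Rintegral => //; first exact: (integrableD measurableT ihXc iB).
  move=> w _; rewrite indicE; have [wB|/negP wB] := boolP (w \in B).
    rewrite mulr1 (le_trans (ranked_inf_leC _ _ _ _ h0 _))//.
    by rewrite lerDr addr_ge0// mulr_ge0.
  rewrite mulr0 addr0; apply: G_prelimit => //; apply: area => Bw.
  by apply: wB; exact: mem_set.
rewrite RintegralD// lerD2l RintegralZl// ler_wpM2l//.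
rewrite -lee_fin /Rintegral integral_indic// setIT fineK//.
exact: fin_num_measure.
Qed.

(** For each [n] the window [q n] is chosen so large that [tree_score_bound] holds
    with a defect that the penalty [n.+1] turns into [e / 4]. On the limit path
    the functionals bound [h] from below only asymptotically and almost surely;
    cut off at [h], they converge to it boundedly, so that a single [n] is good
    on average. The convergence in law applies to the functional for this [n]. *)
Lemma mean_liminf (e : R) : 0 < e ->
  \forall N \near \oo, \int[P']_w h (Y w) <= \int[P]_w h (X N w) + e.
Proof.
move=> e0; pose dl := e / 4.
have dl0 : 0 < dl by rewrite divr_gt0.
have p0 : 0 < dl / (C + 1) by rewrite divr_gt0// ltr_wpDl.
have /choice[q qP] : forall n : nat, exists q : nat, (n < q)%N /\
    \forall N \near \oo, exists B, [/\ measurable B, (P B <= (dl / (C + 1))%:E)%E &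
      forall w, ~ B w -> forall i, (i < N)%N -> tree_area R (fun i u => K i u w) N i <=
        score (window_area q) (q%:R ^+ 2) (rescaled_densities K xi N w) (tree_time R N i)
        + dl / n.+1%:R].
  move=> n; have rho0 : 0 < dl / n.+1%:R by rewrite divr_gt0.
  by have [q nq qP] := tree_score_bound hT hnu hF n.+1 p0 rho0; exists q.
have q0 n : (0 < q n)%N by have [nq _] := qP n; exact: leq_ltn_trans nq.
have mGg n : measurable_fun setT (fun w => G (q n) n (g w)).
  have [_ rg _] := hg; exact: (measurable_random_element rg (@G_continuous _ n (q0 n))).
pose f n w := Num.min (G (q n) n (g w)) (h (Y w)).
have mf n : measurable_fun setT (f n) by exact: measurable_minr.
have f_bounded n w : `|f n w| <= C.
  rewrite ger0_norm /f; first by rewrite ge_min hC orbT.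
  by rewrite le_min h0 ranked_inf_ge0.
have f_cvg : {ae P', forall w, setT w -> (f n w)%:E @[n --> \oo] --> (h (Y w))%:E}.
  apply: filterS2 g_nondecreasing hJ => w g_mono gJ _.
  apply/cvg_EFin; first by near=> n.
  apply/cvgrPdist_le => r r0.
  have [M _ MP] := ranked_inf_limit hC h0 r0 g_mono gJ (h_box w r0).
  exists M => // n /= Mn.
  have [nq _] := qP n; have := MP n.+1 (leqW Mn) (q n) nq; rewrite -/(G (q n) n (g w)).
  rewrite /f minElt; case: ifPn => Gh hG; last by rewrite subrr normr0 ltW.
  rewrite ger0_norm ?subr_ge0; last exact: ltW.
  by rewrite lerBlDr -lerBlDl.
have icst : P'.-integrable setT (EFin \o (fun _ : Omega' => C)).
  by apply: (bounded_integrable P' (M := `|C|)).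
have f_dom : {ae P', forall w n, setT w -> (`|(f n w)%:E| <= (C)%:E)%E}.
  by apply: aeW => w n _; rewrite lee_fin.
have [_ _ int_cvg] := dominated_convergence measurableT
  (fun n => (measurable_EFinP _ _).2 (mf n)) ((measurable_EFinP _ _).2 mhY) f_cvg icst f_dom.
have [n fn] : exists n, \int[P']_w h (Y w) - dl <= \int[P']_w f n w.
  have /cvgrPdist_lt/(_ dl dl0)[n _ fn] :
      \int[P']_w f n w @[n --> \oo] --> \int[P']_w h (Y w).
    apply: fine_cvg; rewrite fineK//.
    exact: integrable_fin_num (bounded_integrable P' mhY (fun w => hN _)).
  by exists n; have /ltr_normlW := fn n (leqnn n); lra.
have fG : \int[P']_w f n w <= \int[P']_w G (q n) n (g w).
  apply: le_Rintegral => //.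
  - exact: bounded_integrable (mf n) (f_bounded n).
  - exact: bounded_integrable (mGg n) (fun w => G_bounded _ _ _).
  - by move=> w _; rewrite ge_min lexx.
have near_G : \forall N \near \oo, \int[P']_w G (q n) n (g w) - dl <=
    \int[P]_w G (q n) n (rescaled_densities K xi N w).
  have [rX _ hc] := hg.
  have cG := @G_continuous _ n (q0 n).
  have mGX N : measurable_fun setT (G (q n) n \o rescaled_densities K xi N).
    exact: measurable_random_element (rX N) cG.
  have := hc _ cG (ex_intro _ C (@G_bounded (q n) n)).
  move=> /(cvg_expectationE P P' mGX (mGg n) (fun N w => G_bounded _ _ _)
    (fun w => G_bounded _ _ _)).
  by move=> /cvgrPdist_lt/(_ dl dl0); apply: filterS => N /ltr_normlW /=; lra.
have [_ near_B] := qP n.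
near=> N.
have [B [mB PB BP]] : exists B, [/\ measurable B, (P B <= (dl / (C + 1))%:E)%E &
      forall w, ~ B w -> forall i, (i < N)%N -> tree_area R (fun i u => K i u w) N i <=
        score (window_area (q n)) ((q n)%:R ^+ 2) (rescaled_densities K xi N w) (tree_time R N i)
        + dl / n.+1%:R].
  by near: N.
have N0 : (0 < N)%N by near: N; exact: nbhs_infty_gt.
have mN : (m <= N)%N by near: N; exact: nbhs_infty_ge.
have GN : \int[P']_w G (q n) n (g w) - dl <= \int[P]_w G (q n) n (rescaled_densities K xi N w).
  by near: N.
have := mean_prelimit n (q0 n) N0 mN (ltW (divr_gt0 dl0 (ltr0Sn R n))) mB PB BP.
rewrite mulrCA divff ?mulr1; last by rewrite pnatr_eq0.
have Cp : C * (dl / (C + 1)) <= dl.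
  by rewrite mulrCA ler_piMr ?(ltW dl0)// ler_pdivrMr ?ltr_wpDl// mul1r lerDl.
move: GN fG fn Cp; rewrite /dl; lra.
Unshelve. all: by end_near. Qed.

End LowerBound.

(** * Convergence of the ordered jumps *)

Theorem corollary1p5 (R : realType)
  (nu : probability nat R) (hnu : critical_offspring nu)
  (F : probability int R) (hF : centered_span1 F)
  (d : measure_display) (Omega : measurableType d) (P : probability Omega R)
  (K : nat -> seq nat -> {RV P >-> nat})
  (xi : nat -> seq nat -> nat -> {RV P >-> int})
  (hT : iid_labeled_trees nu F K xi)
  (d' : measure_display) (Omega' : measurableType d') (P' : probability Omega' R)
  (g : Omega' -> cadlag (c0 R))
  (hg : cvg_in_law P P' (rescaled_densities K xi) g)
  (g_nondecreasing : {ae P', forall w, forall s t x : R,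
     0 <= s -> s <= t -> g w s x <= g w t x})
  (J : nat -> Omega' -> c0 R)
  (J_random : forall k, random_element (J k))
  (hJ : {ae P', forall w, ordered_jumps (g w) (J ^~ w)})
  (m : nat) (hm : (1 <= m)%N) :
  @cvg_in_law R d d' Omega Omega' P P' {ptws 'I_m -> c0 R}
    (fun N w => fun k : 'I_m => ordered_jumps_of_densities K xi N k w)
    (fun w => fun k : 'I_m => J k w).
Proof.
have rX N : @random_element _ _ {ptws 'I_m -> c0 R}
    (fun w => fun k : 'I_m => ordered_jumps_of_densities K xi N k w).
  exact: random_ordered_jumps.
have rY := random_limit_jumps J_random (m := m).
split=> // h ch [M hM].
have mX N := measurable_random_element (rX N) ch.
have mY := measurable_random_element rY ch.
apply/(cvg_expectationE P P' mX mY (fun N w => hM _) (fun w => hM _)).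
apply/cvgrPdist_le => e e0.
have hM2 x : - M <= h x <= M by rewrite -ler_norml.
have c_up : continuous (fun x : {ptws 'I_m -> c0 R} => h x + M).
  by move=> x; exact: cvgD (ch x) (cvg_cst M).
have c_down : continuous (fun x : {ptws 'I_m -> c0 R} => M - h x).
  by move=> x; exact: cvgB (cvg_cst M) (ch x).
have up0 x : 0 <= h x + M by have := hM2 x; lra.
have upM x : h x + M <= M + M by have := hM2 x; lra.
have down0 x : 0 <= M - h x by have := hM2 x; lra.
have downM x : M - h x <= M + M by have := hM2 x; lra.
have lower := mean_liminf hnu hF hT hg g_nondecreasing J_random hJ c_up up0 upM e0.
have upper := mean_liminf hnu hF hT hg g_nondecreasing J_random hJ c_down down0 downM e0.
have iX N := bounded_integrable P (mX N) (fun w => hM _).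
have iY := bounded_integrable P' mY (fun w => hM _).
have icst : P.-integrable setT (EFin \o (fun _ : Omega => M)).
  by apply: (bounded_integrable P (M := `|M|)).
have icst' : P'.-integrable setT (EFin \o (fun _ : Omega' => M)).
  by apply: (bounded_integrable P' (M := `|M|)).
near=> N.
have : \int[P']_w (h (fun k : 'I_m => J k w) + M) <=
    \int[P]_w (h (fun k : 'I_m => ordered_jumps_of_densities K xi N k w) + M) + e.
  near: N; exact: lower.
rewrite !RintegralD// ?Rintegral_prob_cst; last exact: iX.
have : \int[P']_w (M - h (fun k : 'I_m => J k w)) <=
    \int[P]_w (M - h (fun k : 'I_m => ordered_jumps_of_densities K xi N k w)) + e.
  near: N; exact: upper.
rewrite !RintegralB// ?Rintegral_prob_cst; last exact: iX.
by rewrite ler_norml /=; lra.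
Unshelve. all: by end_near. Qed.
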